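(* Let $\alpha=iv$ with $v\in\mathbb{R}$, $v\neq0$, let $b_1,b_2\in\mathbb{C}$, $b\geq0$, and $$A=\begin{bmatrix}\alpha&0&\overline{b_1}+1&0\\0&\alpha&b&\overline{b_2}+1\\ b_1-1&b&-\alpha&0\\0&b_2-1&0&-\alpha\end{bmatrix}.$$ Write $\eta_j=\operatorname{Im}b_j$ for $j=1,2$. Then the numerical range $W(A)$ is bi-elliptical if and only if $$b\neq0,\qquad |b_1|=|b_2|,\qquad\text{and}\qquad v^2b^2=(\eta_1-\eta_2)^2.$$
   Context: The numerical range of $A\in\mathbb{C}^{n\times n}$ is $W(A)=\{\langle Ax,x\rangle: x\in\mathbb{C}^n,\ \|x\|=1\}$. $W(A)$ is called bi-elliptical if it is the convex hull of two (non-degenerate) ellipses with distinct centers, neither of which is contained in the convex hull of the other (so that $W(A)$ is not simply an elliptical disk). Circles count as ellipses. *)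

(* Defs.v *)
(* The complex numbers are R[i], for R : realType. *)
From HB Require Import structures.
From mathcomp Require Import all_boot all_order all_algebra.
From mathcomp Require Import spectral.
From mathcomp Require Import boolp classical_sets reals convex.
From mathcomp Require Import complex.

Set Implicit Arguments.
Unset Strict Implicit.
Unset Printing Implicit Defensive.

Import Order.TTheory GRing.Theory Num.Theory.
Local Open Scope classical_set_scope.
Local Open Scope complex_scope.
Local Open Scope ring_scope.

(* The vectors are columns, whereas [dotmx] is the inner product of rows,
   linear in its first argument: < u, v > = \sum_k u_k * (v_k)^*. *)
Definition numerical_range (R : realType) (n : nat) (A : 'M[R[i]]_n) :
    set R[i] :=
  [set z | exists x : 'cV[R[i]]_n,
     sqrtC (dotmx x^T x^T) = 1 /\ z = dotmx (A *m x)^T x^T].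

(* [Rcomplex R] is R[i] as a vector space over R: convexity is that of the
   real plane. *)
Definition convex_hull (R : realType) (S : set R[i]) : set R[i] :=
  smallest (@convex_set R (Rcomplex R)) S.

(* The ellipse (a curve) with foci f1 and f2 and major axis of length 2a,
   non-degenerate when `|f1 - f2| < 2a; it is a circle when f1 = f2. *)
Definition focal_ellipse (R : realType) (f1 f2 : R[i]) (a : R) : set R[i] :=
  [set z | `|z - f1| + `|z - f2| = (2 * a)%:C].

Definition is_ellipse (R : realType) (E : set R[i]) (c : R[i]) : Prop :=
  exists (f1 f2 : R[i]) (a : R),
    [/\ `|f1 - f2| < (2 * a)%:C, c = (f1 + f2) / 2
      & E = focal_ellipse f1 f2 a].

Definition bi_elliptical (R : realType) (W : set R[i]) : Prop :=
  exists (E1 E2 : set R[i]) (c1 c2 : R[i]),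
    [/\ is_ellipse E1 c1 /\ is_ellipse E2 c2,
        c1 <> c2,
        ~ E1 `<=` convex_hull E2,
        ~ E2 `<=` convex_hull E1
      & W = convex_hull (E1 `|` E2)].

Definition mx4 (C : nzRingType) (rows : seq (seq C)) : 'M[C]_4 :=
  \matrix_(i < 4, j < 4) nth 0 (nth [::] rows i) j.

(* Main.v *)
(* With A = H + iK, B = [[b1, b], [0, b2]] and M = cB + is, the pencil cH + sK is
   [[vs, M^*], [M, -vs]]; its square is block diagonal, so the support function h of
   W(A) satisfies h^2 = (vs)^2 + (largest eigenvalue of M^* M), a number of the form
   tau + |c| sqrt kappa with tau, kappa quadratic forms in (c, s).  An ellipse has
   support function l + sqrt q, with l linear (the center) and q a positive definite
   quadratic form.

   If W(A) is bi-elliptical, one of the ellipses has a center other than 0, and it is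
   exposed in an open set of directions, where (l + sqrt q)^2 = tau + |c| sqrt kappa.
   As sqrt q is irrational, this forces tau = l^2 + q, kappa c^2 = 4 l^2 q and
   l = x c; the resulting relations between the coefficients leave only w = 0 for
   w = 4x^2 - b^2, which is the condition of the theorem.

   Conversely, under the condition, h = |c| b/2 + sqrt q, the support function of the
   convex hull of two translates of one ellipse.  W(A) is convex, and contains the
   outer arcs of the two ellipses: an exposed point of the support line is attained,
   and the end points of the two horizontal edges come from explicit vectors.  Every
   horizontal chord of the hull ends on these arcs. *)
Require Import Defs.
From mathcomp Require Import all_boot all_order all_algebra.
From mathcomp Require Import classical_sets reals complex.
From mathcomp Require Import spectral boolp convex interval_inference ring lra.

Set Implicit Arguments.
Unset Strict Implicit.
Unset Printing Implicit Defensive.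

Import Order.TTheory GRing.Theory Num.Theory.
Local Open Scope complex_scope.
Local Open Scope ring_scope.

(** * Convex hulls and numerical ranges *)

Lemma convex_setP (R : realType) (S : set R[i]) :
  @convex_set R (Rcomplex R) S <->
  (forall (x y : R[i]) (t : R), S x -> S y -> 0 <= t <= 1 ->
    S (t%:C * x + (1 - t)%:C * y)).
Proof.
have scaleE (t : R) (x : R[i]) : (t *: (x : Rcomplex R) : Rcomplex R) = t%:C * x.
  by case: x => x1 x2; congr (_ +i* _) => /=; rewrite !mul0r ?subr0 ?addr0.
split=> [Scvx x y t Sx Sy t01|Scvx x y t Sx Sy].
  have := Scvx x y (Itv01 (andP t01).1 (andP t01).2) (mem_set Sx) (mem_set Sy).
  by move/set_mem; rewrite /conv /= !scaleE.
apply/mem_set; rewrite /conv /= !scaleE; apply: Scvx; try exact: set_mem.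
by rewrite ge0 le1.
Qed.

Lemma sub_convex_hull (R : realType) (S : set R[i]) : (S `<=` convex_hull S)%classic.
Proof. exact: sub_smallest. Qed.

Lemma convex_hull_min (R : realType) (S W : set R[i]) :
  @convex_set R (Rcomplex R) W -> (S `<=` W)%classic -> (convex_hull S `<=` W)%classic.
Proof. by move=> Wcvx SW; apply: smallest_sub. Qed.

Lemma convex_hull_convex (R : realType) (S : set R[i]) :
  @convex_set R (Rcomplex R) (convex_hull S).
Proof.
apply/convex_setP=> x y t Sx Sy t01 W [Wcvx SW].
by move/convex_setP: (Wcvx) => Wc; apply: Wc => //; [apply: Sx | apply: Sy].
Qed.

(** Support functions enter only through their upper bounds: the least such [m] is the value at
    [(c, s)], so they are compared without suprema. *)
Definition in_half_plane {R : realType} (S : set R[i]) (c s m : R) :=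
  forall z, S z -> c * complex.Re z + s * complex.Im z <= m.

Lemma in_half_plane_hull (R : realType) (S : set R[i]) (c s m : R) :
  in_half_plane (convex_hull S) c s m <-> in_half_plane S c s m.
Proof.
split=> [hS z Sz|hS]; first by apply: hS; apply: sub_convex_hull.
apply: (@convex_hull_min _ _ [set z | c * complex.Re z + s * complex.Im z <= m]%classic) => //.
apply/convex_setP=> -[x1 x2] [y1 y2] t /= Hx Hy /andP[t0 t1].
have := ler_wpM2l t0 Hx; have t1' : 0 <= 1 - t by rewrite subr_ge0.
have := ler_wpM2l t1' Hy.
rewrite !mul0r !subr0 !addr0; lra.
Qed.

Lemma dotmx_comb (C : numClosedFieldType) (n : nat) (x y x' y' : 'cV[C]_n) (w : C) :
  dotmx (x + w *: y)^T (x' + w *: y')^T =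
  dotmx x^T x'^T + w^* * dotmx x^T y'^T
    + w * dotmx y^T x'^T + w * w^* * dotmx y^T y'^T.
Proof.
rewrite !dotmxE !linearD /= !linearZ /= !map_mxD !map_mxZ /=.
rewrite mulmxDl !mulmxDr -!scalemxAl -!scalemxAr !mxE.
by ring.
Qed.

Lemma dotmxZZ (C : numClosedFieldType) (n : nat) (x y : 'cV[C]_n) (w : C) :
  dotmx (w *: x)^T (w *: y)^T = w * w^* * dotmx x^T y^T.
Proof.
by have := dotmx_comb 0 x 0 y w; rewrite !add0r trmx0 !linear0l !linear0r !mulr0 !add0r.
Qed.

(** The Rayleigh quotient is invariant under scaling, so dividing by the norm loses nothing;
    explicit vectors then need no normalization. *)
Lemma numerical_rangeP (R : realType) (n : nat) (A : 'M[R[i]]_n) (z : R[i]) :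
  numerical_range A z <->
  exists x : 'cV_n, dotmx x^T x^T != 0 /\ dotmx (A *m x)^T x^T = z * dotmx x^T x^T.
Proof.
split=> [[x [x1 ->]]|[x [x0 Hz]]].
  have x1' : dotmx x^T x^T = 1 by rewrite -[LHS]sqrtCK x1 expr1n.
  by exists x; rewrite x1' oner_neq0 mulr1.
have xgt0 : 0 < dotmx x^T x^T by rewrite lt_def x0 /= dnorm_ge0.
set r := sqrtC (dotmx x^T x^T); have rgt0 : 0 < r by rewrite sqrtC_gt0.
have rconj : (r^-1)^* = r^-1 by apply/CrealP; rewrite realV gtr0_real.
exists (r^-1 *: x); rewrite -scalemxAr !dotmxZZ Hz rconj.
have -> : r^-1 * r^-1 * (z * dotmx x^T x^T) = z * (r^-1 * r^-1 * dotmx x^T x^T) by ring.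
have -> : r^-1 * r^-1 * dotmx x^T x^T = 1.
  by rewrite -[dotmx _ _]sqrtCK -/r expr2 mulrACA mulVf ?mulr1 ?gt_eqF.
by rewrite sqrtC1 mulr1.
Qed.
(* Toeplitz-Hausdorff: after the affine normalization z1 = 0, z2 = 1, a suitable
   phase w makes the compression to span(x, y) real along x + r w y, so that the
   point of parameter s is reached at a root r of a real quadratic equation. *)
Lemma numerical_range_convex (R : realType) (n : nat) (A : 'M[R[i]]_n) :
  @convex_set R (Rcomplex R) (numerical_range A).
Proof.
apply/convex_setP=> z1 z2 t Hz1 Hz2 /andP[t0 t1].
have [z12|z12] := eqVneq z1 z2.
  by rewrite z12 -mulrDl -rmorphD /= subrKC mul1r.
have [{}t0|tn0] := eqVneq t 0; first by rewrite t0 subr0 mul0r mul1r add0r.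
have [{}t1|tn1] := eqVneq t 1; first by rewrite t1 subrr mul0r mul1r addr0.
have {t0 tn0} t_gt0 : 0 < t by rewrite lt_def tn0.
have {t1 tn1} s_gt0 : 0 < 1 - t by rewrite subr_gt0 lt_neqAle tn1.
have [x [x1 z1E]] := Hz1; have [y [y1 z2E]] := Hz2.
have {}x1 : dotmx x^T x^T = 1 by rewrite -[LHS]sqrtCK x1 expr1n.
have {}y1 : dotmx y^T y^T = 1 by rewrite -[LHS]sqrtCK y1 expr1n.
set d := z2 - z1; have d0 : d != 0 by rewrite subr_eq0 eq_sym.
(* [P] and [Q] are the cross terms, for the pair [(x, y)], of the form of [(A - z1) / d], whose
   values at [x] and [y] are 0 and 1. *)
set P := (dotmx (A *m x)^T y^T - z1 * dotmx x^T y^T) / d.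
set Q := (dotmx (A *m y)^T x^T - z1 * dotmx y^T x^T) / d.
(* The imaginary part of [w^* P + w Q] is [w1 (p2 + q2) - w2 (p1 - q1)]: if both coefficients vanish
   [w = 1] works, otherwise [w] is read off them. It need not have modulus 1, hence [N] below. *)
have [w w0 [g gE]] : exists2 w : R[i], w != 0 & exists g : R, w^* * P + w * Q = g%:C.
  case: P Q => [p1 p2] [q1 q2].
  have [/andP[/eqP e1 /eqP e2]|ne] := boolP ((p1 - q1 == 0) && (p2 + q2 == 0)).
    exists 1; rewrite ?oner_neq0 //; exists (p1 + q1); rewrite rmorph1 !mul1r.
    by congr (_ +i* _).
  exists ((p1 - q1) +i* (p2 + q2)).
    by move: ne; apply: contra; rewrite eq_complex /=.
  exists ((p1 - q1) * (p1 + q1) + (p2 + q2) * (p2 - q2)).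
  by congr (_ +i* _); rewrite /=; ring.
have [N N0 NE] : exists2 N : R, 0 < N & w * w^* = N%:C.
  exists (complex.Re w ^+ 2 + complex.Im w ^+ 2).
    by rewrite -ltcR add_Re2_Im2 exprn_gt0 // normr_gt0.
  by rewrite add_Re2_Im2 sqr_normc.
have [k kE] : exists k : R, w^* * dotmx x^T y^T + w * dotmx y^T x^T = k%:C.
  have -> : dotmx y^T x^T = (dotmx x^T y^T)^*.
    rewrite !dotmxE !mxE rmorph_sum; apply: eq_bigr => j _ /=.
    by rewrite !mxE rmorphM /= conjCK mulrC.
  case: w (dotmx x^T y^T) {w0 gE NE} => [w1 w2] [p1 p2].
  by exists (2 * (w1 * p1 + w2 * p2)); congr (_ +i* _); rewrite /=; ring.
(* The left side is the normalized form at [x + r w y], and the last factor is the squared norm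
   there. As a quadratic in [r], the equation has leading coefficient [t N > 0] and constant term
   [t - 1 < 0], hence a real root. *)
have [r rE] : exists r : R, r ^+ 2 * N + r * g = (1 - t) * (1 + r ^+ 2 * N + r * k).
  set a := t * N; set b := g - (1 - t) * k.
  have a0 : 0 < a by rewrite mulr_gt0.
  have D0 : 0 <= b ^+ 2 + 4 * a * (1 - t) by nra.
  set e := Num.sqrt (b ^+ 2 + 4 * a * (1 - t)).
  have e2 : e ^+ 2 = b ^+ 2 + 4 * a * (1 - t) by rewrite sqr_sqrtr.
  exists ((e - b) / (2 * a)).
  have : a * ((e - b) / (2 * a)) ^+ 2 + b * ((e - b) / (2 * a)) - (1 - t) = 0.
    rewrite (_ : _ - _ = (e ^+ 2 - (b ^+ 2 + 4 * a * (1 - t))) / (4 * a)); last first.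
      by field; rewrite gt_eqF.
    by rewrite e2 subrr mul0r.
  by rewrite /a /b; lra.
set z := _ + _; have zE : z = z1 + (1 - t)%:C * d.
  by rewrite /z /d -[in LHS](subKr 1 t) rmorphB rmorph1; ring.
have conjr (u : R) : (u%:C : R[i])^* = u%:C by apply/CrealP/complex_realP; exists u.
have nE : dotmx (x + (r%:C * w) *: y)^T (x + (r%:C * w) *: y)^T
    = (1 + r ^+ 2 * N + r * k)%:C.
  rewrite dotmx_comb x1 y1 rmorphM /= conjr.
  rewrite !rmorphD expr2 !rmorphM /= -NE -kE rmorph1; ring.
apply/numerical_rangeP; exists (x + (r%:C * w) *: y); split; last first.
  rewrite nE mulmxDr -scalemxAr dotmx_comb -z1E -z2E rmorphM /= conjr zE.
  have dK (u u' : R[i]) : u = (u - u') / d * d + u' by rewrite divfK // subrK.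
  have PE : dotmx (A *m x)^T y^T = P * d + z1 * dotmx x^T y^T := dK _ _.
  have QE : dotmx (A *m y)^T x^T = Q * d + z1 * dotmx y^T x^T := dK _ _.
  have := congr1 (fun u : R => u%:C) rE; rewrite rmorphM /= => rE'.
  rewrite PE QE mulrDl [(1 - t)%:C * d]mulrC -[d * _ * _]mulrA -rE'.
  rewrite !rmorphD expr2 !rmorphM /= -NE -kE -gE rmorph1.
  have -> : z2 = z1 + d by rewrite /d subrKC.
  ring.
(* Were this vector 0, [x] would be a multiple of [y] and give the same value, against
   [z1 != z2]. *)
rewrite dnorm_eq0 trmx_eq0; apply: contraNneq z12 => /eqP.
rewrite addr_eq0 => /eqP xE; rewrite z1E z2E xE.
have r1 : r%:C * w * (r%:C * w)^* = 1.
  have := x1; rewrite xE -scaleNr dotmxZZ y1 mulr1 rmorphN mulrNN; exact.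
by rewrite -scaleNr -scalemxAr dotmxZZ rmorphN mulrNN r1 mul1r.
Qed.

(** * The support function of W(A) *)

(** [dotc x y] and [crossc x y] are the real and imaginary parts of [x^* * y]. *)
Definition dotc {R : realType} (x y : R[i]) : R :=
  complex.Re x * complex.Re y + complex.Im x * complex.Im y.

Definition crossc {R : realType} (x y : R[i]) : R :=
  complex.Re x * complex.Im y - complex.Im x * complex.Re y.

Definition mxA {R : realType} (v : R) (b1 b2 : R[i]) (b : R) : 'M[R[i]]_4 :=
  mx4
    [:: [:: 'i%C * v%:C; 0;           b1^* + 1;      0             ];
        [:: 0;           'i%C * v%:C; b%:C;          b2^* + 1      ];
        [:: b1 - 1;      b%:C;        - ('i%C * v%:C); 0           ];
        [:: 0;           b2 - 1;      0;             - ('i%C * v%:C) ]].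

(** [reA] and [imA] are the real and imaginary parts of [<A x, x>] for [A = mxA v b1 b2 b]. *)
Definition reA {R : realType} (b1 b2 : R[i]) (b : R) (x1 x2 x3 x4 : R[i]) : R :=
  2 * (complex.Re b1 * dotc x1 x3 + complex.Im b1 * crossc x1 x3 + b * dotc x2 x3
       + complex.Re b2 * dotc x2 x4 + complex.Im b2 * crossc x2 x4).

Definition imA {R : realType} (v : R) (x1 x2 x3 x4 : R[i]) : R :=
  v * (dotc x1 x1 + dotc x2 x2 - dotc x3 x3 - dotc x4 x4)
  + 2 * (crossc x1 x3 + crossc x2 x4).

Definition sqnorm4 {R : realType} (x1 x2 x3 x4 : R[i]) : R :=
  dotc x1 x1 + dotc x2 x2 + dotc x3 x3 + dotc x4 x4.

Lemma ord4E : [/\ lift ord0 ord0 = 1 :> 'I_4, lift ord0 (lift ord0 ord0) = 2 :> 'I_4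
  & lift ord0 (lift ord0 (lift ord0 ord0)) = 3 :> 'I_4].
Proof. by split; apply/val_inj. Qed.

Lemma dotmx4E (C : numClosedFieldType) (x y : 'cV[C]_4) :
  dotmx x^T y^T = x 0 0 * (y 0 0)^* + x 1 0 * (y 1 0)^*
    + x 2 0 * (y 2 0)^* + x 3 0 * (y 3 0)^*.
Proof.
case: ord4E => o1 o2 o3.
by rewrite dotmxE !mxE !big_ord_recl big_ord0 /= addr0 !addrA !mxE o1 o2 o3.
Qed.

Lemma mxA_mulE (R : realType) (v : R) (b1 b2 : R[i]) (b : R) (x : 'cV[R[i]]_4) :
  let y := mxA v b1 b2 b *m x in
  [/\ y 0 0 = 'i%C * v%:C * x 0 0 + (b1^* + 1) * x 2 0,
      y 1 0 = 'i%C * v%:C * x 1 0 + b%:C * x 2 0 + (b2^* + 1) * x 3 0,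
      y 2 0 = (b1 - 1) * x 0 0 + b%:C * x 1 0 - 'i%C * v%:C * x 2 0
    & y 3 0 = (b2 - 1) * x 1 0 - 'i%C * v%:C * x 3 0].
Proof.
case: ord4E => o1 o2 o3.
by split; rewrite /= !mxE !big_ord_recl big_ord0 !mxE /= o1 o2 o3; ring.
Qed.

Lemma numerical_range_mxAP (R : realType) (v : R) (b1 b2 : R[i]) (b : R) (z : R[i]) :
  numerical_range (mxA v b1 b2 b) z <->
  exists x1 x2 x3 x4 : R[i],
    [/\ sqnorm4 x1 x2 x3 x4 != 0,
        reA b1 b2 b x1 x2 x3 x4 = complex.Re z * sqnorm4 x1 x2 x3 x4
      & imA v x1 x2 x3 x4 = complex.Im z * sqnorm4 x1 x2 x3 x4].
Proof.
have normE (x : 'cV[R[i]]_4) :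
    dotmx x^T x^T = (sqnorm4 (x 0 0) (x 1 0) (x 2 0) (x 3 0))%:C.
  rewrite dotmx4E /sqnorm4 /dotc.
  case: (x 0 0) (x 1 0) (x 2 0) (x 3 0) => [a1 c1] [a2 c2] [a3 c3] [a4 c4].
  by congr (_ +i* _); rewrite /=; ring.
have formE (x : 'cV[R[i]]_4) : dotmx (mxA v b1 b2 b *m x)^T x^T =
    reA b1 b2 b (x 0 0) (x 1 0) (x 2 0) (x 3 0)
    +i* imA v (x 0 0) (x 1 0) (x 2 0) (x 3 0).
  rewrite dotmx4E; case: (mxA_mulE v b1 b2 b x) => -> -> -> ->.
  rewrite /reA /imA /dotc /crossc.
  case: (x 0 0) (x 1 0) (x 2 0) (x 3 0) => [a1 c1] [a2 c2] [a3 c3] [a4 c4].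
  case: b1 b2 => [u1 e1] [u2 e2].
  by congr (_ +i* _); rewrite /=; ring.
have scaleE (N : R) : z * N%:C = (complex.Re z * N) +i* (complex.Im z * N).
  by case: z => u1 u2; congr (_ +i* _); rewrite /=; ring.
split=> [/numerical_rangeP[x []]|[x1 [x2 [x3 [x4 [N0 reE imE]]]]]].
  rewrite normE formE scaleE => N0 [reE imE].
  exists (x 0 0), (x 1 0), (x 2 0), (x 3 0); split=> //.
  by apply: contraNneq N0 => ->.
apply/numerical_rangeP; exists (\col_(i < 4) nth 0 [:: x1; x2; x3; x4] i).
rewrite normE formE scaleE !mxE /= reE imE; split=> //.
by apply: contraNneq N0 => -[->].
Qed.

(** A Hermitian 2x2 matrix of determinant 0 with nonnegative diagonal is positive semidefinite: [al]
    times the form is a sum of squares, and [al = 0] kills the off-diagonal entry. *)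
Lemma hermitian2_ge0 (R : realType) (al ga be1 be2 : R) (x y : R[i]) :
  0 <= al -> 0 <= ga -> al * ga = be1 ^+ 2 + be2 ^+ 2 ->
  0 <= al * dotc x x + ga * dotc y y - 2 * (be1 * dotc x y + be2 * crossc x y).
Proof.
case: x y => [x1 x2] [y1 y2]; rewrite /dotc /crossc /= => al0 ga0 det0.
have [al00|al00] := eqVneq al 0.
  move: det0; rewrite al00 mul0r => /esym/eqP.
  rewrite paddr_eq0 ?sqr_ge0 // !sqrf_eq0 => /andP[/eqP -> /eqP ->].
  by rewrite !mul0r !addr0 mulr0 subr0 add0r mulr_ge0 // addr_ge0 // -expr2 sqr_ge0.
rewrite -(pmulr_rge0 _ (_ : 0 < al)); last by rewrite lt_def al00.
rewrite [leRHS](_ : _ = (al * x1 - be1 * y1 - be2 * y2) ^+ 2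
  + (al * x2 - be1 * y2 + be2 * y1) ^+ 2
  + (al * ga - (be1 ^+ 2 + be2 ^+ 2)) * (y1 ^+ 2 + y2 ^+ 2)); last by ring.
by rewrite det0 subrr mul0r addr0 addr_ge0 // sqr_ge0.
Qed.

Lemma hermitian2_isotropic (R : realType) (al ga be1 be2 : R) :
  al * ga = be1 ^+ 2 + be2 ^+ 2 -> exists x y : R[i],
  dotc x x + dotc y y != 0 /\
  al * dotc x x + ga * dotc y y - 2 * (be1 * dotc x y + be2 * crossc x y) = 0.
Proof.
move=> det0; have [ga0|ga0] := eqVneq ga 0.
  exists (0 +i* 0), (1 +i* 0); rewrite /dotc /crossc ga0 /=.
  by rewrite !(mul0r, mulr0, addr0, subr0, add0r, mulr1, oppr0); split; rewrite ?oner_neq0.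
exists (ga%:C), (be1 +i* be2); rewrite /dotc /crossc /=; split.
  rewrite !mulr0 addr0 gt_eqF // ltr_pwDl //.
    by rewrite -expr2 exprn_even_gt0.
  by rewrite addr_ge0 // -expr2 sqr_ge0.
rewrite [LHS](_ : _ = ga * (al * ga - (be1 ^+ 2 + be2 ^+ 2))); last by ring.
by rewrite det0 subrr mulr0.
Qed.

(* [l] is the largest eigenvalue of M^* M for M = [[k1 + i k2, f], [0, g1 + i g2]]. *)
Definition top_sqsingular {R : realType} (k1 k2 f g1 g2 l : R) : Prop :=
  [/\ k1 ^+ 2 + k2 ^+ 2 <= l, f ^+ 2 + g1 ^+ 2 + g2 ^+ 2 <= l
    & (l - (k1 ^+ 2 + k2 ^+ 2)) * (l - (f ^+ 2 + g1 ^+ 2 + g2 ^+ 2))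
      = f ^+ 2 * (k1 ^+ 2 + k2 ^+ 2)].

Lemma dotcc_ge0 (R : realType) (x : R[i]) : 0 <= dotc x x.
Proof. by rewrite /dotc -!expr2 addr_ge0 ?sqr_ge0. Qed.

(* c Re A + s Im A = [[w, M^*], [M, - w]] with M = c B + i s and w = v s. *)
Lemma pencilE (R : realType) (v : R) (b1 b2 : R[i]) (b c s : R) (x1 x2 x3 x4 : R[i]) :
  let y1 := ((c * complex.Re b1) +i* (c * complex.Im b1 + s)) * x1 + (c * b)%:C * x2 in
  let y2 := ((c * complex.Re b2) +i* (c * complex.Im b2 + s)) * x2 in
  c * reA b1 b2 b x1 x2 x3 x4 + s * imA v x1 x2 x3 x4 =
  v * s * (dotc x1 x1 + dotc x2 x2 - dotc x3 x3 - dotc x4 x4)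
    + 2 * (dotc y1 x3 + dotc y2 x4).
Proof.
case: x1 x2 x3 x4 b1 b2 => [a1 c1] [a2 c2] [a3 c3] [a4 c4] [u1 e1] [u2 e2].
by rewrite /reA /imA /dotc /crossc /=; ring.
Qed.

(** This displays the entries of [M^* M]; [top_sqsingular] says that [l - M^* M] has nonnegative
    diagonal and determinant 0. *)
Lemma sqnormM (R : realType) (k1 k2 f g1 g2 : R) (x1 x2 : R[i]) :
  let y1 := (k1 +i* k2) * x1 + f%:C * x2 in
  let y2 := (g1 +i* g2) * x2 in
  dotc y1 y1 + dotc y2 y2 =
  (k1 ^+ 2 + k2 ^+ 2) * dotc x1 x1 + (f ^+ 2 + g1 ^+ 2 + g2 ^+ 2) * dotc x2 x2
    + 2 * (f * k1 * dotc x1 x2 + f * k2 * crossc x1 x2).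
Proof. by case: x1 x2 => [a1 c1] [a2 c2]; rewrite /dotc /crossc /=; ring. Qed.

(** Multiplied by [h + w], the difference of the two sides is at least [|y - (h + w) r|^2]. If
    [h + w = 0], the hypothesis forces [y = 0]. *)
Lemma pencil_le (R : realType) (w h : R) (p1 p2 y1 y2 r1 r2 : R[i]) :
  `|w| <= h ->
  dotc y1 y1 + dotc y2 y2 <= (h ^+ 2 - w ^+ 2) * (dotc p1 p1 + dotc p2 p2) ->
  w * (dotc p1 p1 + dotc p2 p2 - dotc r1 r1 - dotc r2 r2)
    + 2 * (dotc y1 r1 + dotc y2 r2) <= h * sqnorm4 p1 p2 r1 r2.
Proof.
move=> wh; have := conj (dotcc_ge0 p1) (dotcc_ge0 p2).
rewrite /sqnorm4; move: (dotc p1 p1) (dotc p2 p2) => P1 P2 [P10 P20].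
case: y1 y2 r1 r2 => [y11 y12] [y21 y22] [r11 r12] [r21 r22].
rewrite /dotc /= => yle; move: wh; rewrite ler_norml => /andP[wh1 wh2].
have [hw0|hw0] := eqVneq (h + w) 0.
  have hw2 : h ^+ 2 - w ^+ 2 = 0 by rewrite subr_sqr hw0 mulr0.
  move: yle; rewrite hw2 mul0r => yle.
  have y0 (u1 u2 u3 u4 : R) : u1 * u1 + u2 * u2 + (u3 * u3 + u4 * u4) <= 0 -> u1 = 0.
    by move=> u0; apply/eqP; rewrite -sqrf_eq0 eq_le sqr_ge0 andbT; nra.
  have e1 : y11 = 0 by apply: y0 yle.
  have e2 : y12 = 0 by apply: (y0 _ y11 y21 y22); lra.
  have e3 : y21 = 0 by apply: (y0 _ y22 y11 y12); lra.
  have e4 : y22 = 0 by apply: (y0 _ y21 y11 y12); lra.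
  have -> : w = - h by lra.
  by rewrite e1 e2 e3 e4; nra.
have {}hw0 : 0 < h + w by rewrite lt_def hw0; lra.
rewrite -(ler_pM2l hw0).
have S1 := sqr_ge0 (y11 - (h + w) * r11); have S2 := sqr_ge0 (y12 - (h + w) * r12).
have S3 := sqr_ge0 (y21 - (h + w) * r21); have S4 := sqr_ge0 (y22 - (h + w) * r22).
by lra.
Qed.

(** [h] is the largest eigenvalue of the pencil: with [w = v s] and [l = h^2 - w^2], the matrix
    [l - M^* M] is positive semidefinite, which bounds the form, and singular, which yields an
    eigenvector. *)
Lemma numerical_range_support (R : realType) (v : R) (b1 b2 : R[i]) (b c s h : R) :
  0 <= h ->
  top_sqsingular (c * complex.Re b1) (c * complex.Im b1 + s) (c * b)
    (c * complex.Re b2) (c * complex.Im b2 + s) (h ^+ 2 - (v * s) ^+ 2) ->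
  in_half_plane (numerical_range (mxA v b1 b2 b)) c s h /\
  exists2 z, numerical_range (mxA v b1 b2 b) z &
    c * complex.Re z + s * complex.Im z = h.
Proof.
move=> h0; set k1 := c * complex.Re b1; set k2 := c * complex.Im b1 + s.
set f := c * b; set g1 := c * complex.Re b2; set g2 := c * complex.Im b2 + s.
set w := v * s; set l := _ - _ => -[l1 l2 detl].
have detl' : (l - (k1 ^+ 2 + k2 ^+ 2)) * (l - (f ^+ 2 + g1 ^+ 2 + g2 ^+ 2))
    = (f * k1) ^+ 2 + (f * k2) ^+ 2 by rewrite detl; ring.
have l0 : 0 <= l by apply: le_trans l1; rewrite addr_ge0 ?sqr_ge0.
have wh : `|w| <= h.
  by rewrite -ler_sqr ?nnegrE // real_normK ?num_real // -subr_ge0.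
split=> [z /numerical_range_mxAP[x1 [x2 [x3 [x4 [N0 reE imE]]]]]|].
  have {}N0 : 0 < sqnorm4 x1 x2 x3 x4.
    rewrite lt_def N0 /=.
    exact: addr_ge0 (addr_ge0 (addr_ge0 (dotcc_ge0 _) (dotcc_ge0 _)) (dotcc_ge0 _)) (dotcc_ge0 _).
  rewrite -(ler_pM2r N0) mulrDl -!mulrA -reE -imE pencilE; apply: pencil_le => //.
  rewrite sqnormM -/k1 -/k2 -/f -/g1 -/g2 -subr_ge0 -/w -/l.
  apply: le_trans (hermitian2_ge0 x1 x2 _ _ detl') _; rewrite ?subr_ge0 //.
  by rewrite le_eqVlt; apply/orP; left; apply/eqP; ring.
have attained (x1 x2 x3 x4 : R[i]) : sqnorm4 x1 x2 x3 x4 != 0 ->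
    c * reA b1 b2 b x1 x2 x3 x4 + s * imA v x1 x2 x3 x4 = h * sqnorm4 x1 x2 x3 x4 ->
    exists2 z, numerical_range (mxA v b1 b2 b) z &
      c * complex.Re z + s * complex.Im z = h.
  move=> N0 E; set N := sqnorm4 x1 x2 x3 x4 in N0 E.
  exists ((reA b1 b2 b x1 x2 x3 x4 / N) +i* (imA v x1 x2 x3 x4 / N)).
    by apply/numerical_range_mxAP; exists x1, x2, x3, x4; rewrite /= !divfK.
  have divE (a e : R) : c * (a / N) + s * (e / N) = (c * a + s * e) / N by ring.
  by rewrite /= divE E mulfK.
(* Here [h = - w], the value of the form at a basis vector of the second block. *)
have [hw0|hw0] := eqVneq (h + w) 0.
  apply: (attained 0 0 1 0).
    by rewrite /sqnorm4 /dotc /= !(mul0r, addr0, add0r, mulr1) oner_neq0.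
  rewrite pencilE -/w /sqnorm4 /dotc /= !(mul0r, mulr0, addr0, add0r, mulr1, subr0).
  by move: hw0; rewrite addrC => /eqP; rewrite addr_eq0 => /eqP ->; ring.
(* If [x] is isotropic for [l - M^* M], hence in its kernel, then [((h + w) x, M x)] is an
   eigenvector of the pencil for [h]. *)
have [x1 [x2 [n0 iso]]] := hermitian2_isotropic detl'.
set y1 := (k1 +i* k2) * x1 + f%:C * x2; set y2 := (g1 +i* g2) * x2.
have yE : dotc y1 y1 + dotc y2 y2 = l * (dotc x1 x1 + dotc x2 x2).
  by rewrite sqnormM -[LHS]addr0 -iso; ring.
have dotZ (a : R) (u : R[i]) : dotc (a%:C * u) (a%:C * u) = a ^+ 2 * dotc u u.
  by case: u => u1 u2; rewrite /dotc /=; ring.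
have hw_gt0 : 0 < h + w.
  rewrite lt_def hw0 -lerBlDr sub0r; apply: le_trans wh.
  by rewrite -normrN ler_norm.
have h_gt0 : 0 < h.
  rewrite lt_def h0 andbT; apply: contraTneq hw_gt0 => h00.
  by move: wh; rewrite h00 normr_le0 add0r => /eqP ->; rewrite ltxx.
have NE : sqnorm4 ((h + w)%:C * x1) ((h + w)%:C * x2) y1 y2
    = 2 * h * (h + w) * (dotc x1 x1 + dotc x2 x2).
  by rewrite /sqnorm4 -addrA yE !dotZ /l; ring.
apply: (attained ((h + w)%:C * x1) ((h + w)%:C * x2) y1 y2).
  by rewrite NE !mulf_neq0 // ?gt_eqF // pnatr_eq0.
rewrite pencilE -/k1 -/k2 -/f -/g1 -/g2 -/w NE !dotZ.
have -> : (k1 +i* k2) * ((h + w)%:C * x1) + f%:C * ((h + w)%:C * x2) = (h + w)%:C * y1.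
  by rewrite /y1; ring.
have -> : (g1 +i* g2) * ((h + w)%:C * x2) = (h + w)%:C * y2 by rewrite /y2; ring.
have dotZl (a : R) (u : R[i]) : dotc (a%:C * u) u = a * dotc u u.
  by case: u => u1 u2; rewrite /dotc /=; ring.
rewrite !dotZl.
have -> : w * ((h + w) ^+ 2 * dotc x1 x1 + (h + w) ^+ 2 * dotc x2 x2 - dotc y1 y1 - dotc y2 y2)
    + 2 * ((h + w) * dotc y1 y1 + (h + w) * dotc y2 y2)
  = w * (h + w) ^+ 2 * (dotc x1 x1 + dotc x2 x2)
    + (2 * h + w) * (dotc y1 y1 + dotc y2 y2) by ring.
by rewrite yE /l; ring.
Qed.

(** * Ellipses and their support functions *)

(* The ellipse with support function sqrt (A c^2 + 2 B c s + C s^2), centered at 0,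
   is the level set of the adjugate quadratic form at A C - B^2. *)
Definition support_sq {R : realType} (A B C c s : R) : R :=
  A * c ^+ 2 + 2 * B * c * s + C * s ^+ 2.

Definition adj_form {R : realType} (A B C x y : R) : R :=
  C * x ^+ 2 - 2 * B * x * y + A * y ^+ 2.

Definition centered_ellipse {R : realType} (A B C : R) (c : R[i]) : set R[i] :=
  [set z | adj_form A B C (complex.Re z - complex.Re c) (complex.Im z - complex.Im c)
           = A * C - B ^+ 2]%classic.

(** With [k = <w, d>], one has [r'^2 - r^2 = 4 k], so [r + r' = 2 a] means [a r' = a^2 + k] and
    [a r = a^2 - k]; squared, both become [k^2 = a^2 (|w|^2 + |d|^2 - a^2)]. *)
Lemma focal_sumE (R : realType) (a d1 d2 w1 w2 : R) : 0 < a -> d1 ^+ 2 + d2 ^+ 2 < a ^+ 2 ->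
  Num.sqrt ((w1 - d1) ^+ 2 + (w2 - d2) ^+ 2) + Num.sqrt ((w1 + d1) ^+ 2 + (w2 + d2) ^+ 2)
    = 2 * a <->
  adj_form (a ^+ 2 - d2 ^+ 2) (d1 * d2) (a ^+ 2 - d1 ^+ 2) w1 w2
    = (a ^+ 2 - d2 ^+ 2) * (a ^+ 2 - d1 ^+ 2) - (d1 * d2) ^+ 2.
Proof.
move=> a0 da; rewrite /adj_form; set k := w1 * d1 + w2 * d2.
set r := Num.sqrt _; set r' := Num.sqrt _.
have r2 : r ^+ 2 = (w1 - d1) ^+ 2 + (w2 - d2) ^+ 2 by rewrite sqr_sqrtr ?addr_ge0 ?sqr_ge0.
have r2' : r' ^+ 2 = (w1 + d1) ^+ 2 + (w2 + d2) ^+ 2 by rewrite sqr_sqrtr ?addr_ge0 ?sqr_ge0.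
have r0 : 0 <= r := sqrtr_ge0 _; have r0' : 0 <= r' := sqrtr_ge0 _.
have a20 : 0 < a ^+ 2 by rewrite exprn_gt0.
split=> [rr|pol].
  have ar : a * r' = a ^+ 2 + k.
    have : (r' ^+ 2 - r ^+ 2) = (r' - r) * (2 * a) by rewrite -rr; ring.
    have : a * (r + r') = 2 * a ^+ 2 by rewrite rr; ring.
    by rewrite r2 r2' /k; lra.
  have : (a * r') ^+ 2 = (a ^+ 2 + k) ^+ 2 by rewrite ar.
  by rewrite exprMn r2' /k; lra.
(* Cauchy-Schwarz gives [|k| <= a^2], so [a^2 - k] and [a^2 + k] are nonnegative and the squared
   equations can be undone. *)
have k2 : k ^+ 2 <= (a ^+ 2) ^+ 2.
  have CS : k ^+ 2 <= (w1 ^+ 2 + w2 ^+ 2) * (d1 ^+ 2 + d2 ^+ 2).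
    by rewrite -subr_ge0 (_ : _ - _ = (w1 * d2 - w2 * d1) ^+ 2) ?sqr_ge0 // /k; ring.
  have pol' : k ^+ 2 = a ^+ 2 * (w1 ^+ 2 + w2 ^+ 2) - a ^+ 2 * (a ^+ 2 - (d1 ^+ 2 + d2 ^+ 2)).
    by move: pol; rewrite /k; lra.
  have aD : 0 < a ^+ 2 - (d1 ^+ 2 + d2 ^+ 2) by rewrite subr_gt0.
  have D0 : 0 <= d1 ^+ 2 + d2 ^+ 2 by rewrite addr_ge0 ?sqr_ge0.
  rewrite -(ler_pM2r aD).
  have := ler_wpM2l (ltW a20) CS.
  move: (w1 ^+ 2 + _) (d1 ^+ 2 + _) (a ^+ 2) (k ^+ 2) pol' aD D0 a20 => W D a2 k2 -> aD D0 a20.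
  by have := mulr_gt0 a20 (mulr_gt0 aD aD); lra.
have [k_lo k_hi] : - a ^+ 2 <= k /\ k <= a ^+ 2.
  by apply/andP; rewrite -ler_norml -ler_sqr ?nnegrE ?(ltW a20) // real_normK ?num_real.
have arE : a * r = a ^+ 2 - k.
  apply/eqP; rewrite -(@eqrXn2 _ 2) ?mulr_ge0 ?subr_ge0 // ?(ltW a0) //.
  by apply/eqP; rewrite exprMn r2; move: pol; rewrite /k; lra.
have arE' : a * r' = a ^+ 2 + k.
  have ak0 : 0 <= a ^+ 2 + k by lra.
  apply/eqP; rewrite -(@eqrXn2 _ 2) ?mulr_ge0 // ?(ltW a0) //.
  by apply/eqP; rewrite exprMn r2'; move: pol; rewrite /k; lra.
by apply: (mulfI (lt0r_neq0 a0)); rewrite mulrDr arE arE'; ring.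
Qed.

Lemma focal_ellipseE (R : realType) (c d : R[i]) (a : R) : `|d| < a%:C ->
  let d1 := complex.Re d in let d2 := complex.Im d in
  focal_ellipse (c + d) (c - d) a =
  centered_ellipse (a ^+ 2 - d2 ^+ 2) (d1 * d2) (a ^+ 2 - d1 ^+ 2) c.
Proof.
case: c d => [c1 c2] [d1 d2] /=; rewrite normc_def ltcR => da.
have a0 : 0 < a by apply: le_lt_trans da; exact: sqrtr_ge0.
have {}da : d1 ^+ 2 + d2 ^+ 2 < a ^+ 2.
  by rewrite -[ltLHS]sqr_sqrtr ?addr_ge0 ?sqr_ge0 // ltr_sqr ?nnegrE ?sqrtr_ge0 // ltW.
apply/seteqP; split=> -[z1 z2]; rewrite /focal_ellipse /centered_ellipse /= !normc_def /=.
  rewrite -rmorphD /= => /complexI E; apply/focal_sumE => //.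
  by rewrite -[RHS]E; congr (Num.sqrt _ + Num.sqrt _); ring.
move/(focal_sumE _ _ a0 da) => E; rewrite -rmorphD /= -[in RHS]E.
by congr (_%:C); congr (Num.sqrt _ + Num.sqrt _); ring.
Qed.

Lemma is_ellipse_centered (R : realType) (E : set R[i]) (c : R[i]) : is_ellipse E c ->
  exists A B C : R, [/\ 0 < A, 0 < A * C - B ^+ 2 & E = centered_ellipse A B C c].
Proof.
move=> [f1 [f2 [a [fa cE ->]]]].
set d := (f1 - f2) / 2.
have -> : f1 = c + d by rewrite cE /d; field.
have -> : f2 = c - d by rewrite cE /d; field.
have da : `|d| < a%:C.
  rewrite /d normrM normfV [`|2|]ger0_norm ?ler0n // ltr_pdivrMr ?ltr0n //.
  by rewrite mulrC; move: fa; rewrite rmorphM /= rmorph_nat.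
rewrite focal_ellipseE //.
exists (a ^+ 2 - complex.Im d ^+ 2), (complex.Re d * complex.Im d), (a ^+ 2 - complex.Re d ^+ 2).
move: da; rewrite normc_def ltcR => da.
have a0 : 0 < a by apply: le_lt_trans da; exact: sqrtr_ge0.
have {}da : complex.Re d ^+ 2 + complex.Im d ^+ 2 < a ^+ 2.
  by rewrite -[ltLHS]sqr_sqrtr ?addr_ge0 ?sqr_ge0 // ltr_sqr ?nnegrE ?sqrtr_ge0 // ltW.
split=> //; first by have := sqr_ge0 (complex.Re d); lra.
rewrite (_ : _ - _ = a ^+ 2 * (a ^+ 2 - (complex.Re d ^+ 2 + complex.Im d ^+ 2))); last by ring.
by rewrite mulr_gt0 ?exprn_gt0 ?subr_gt0.
Qed.

Lemma centered_ellipse_is_ellipse (R : realType) (A B C : R) (c : R[i]) :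
  0 < A -> 0 < A * C - B ^+ 2 -> is_ellipse (centered_ellipse A B C c) c.
Proof.
move=> A0 D0.
set e := Num.sqrt ((A - C) ^+ 2 + 4 * B ^+ 2).
have e2 : e ^+ 2 = (A - C) ^+ 2 + 4 * B ^+ 2.
  by rewrite sqr_sqrtr // addr_ge0 ?sqr_ge0 // mulr_ge0 ?sqr_ge0.
have e0 : 0 <= e := sqrtr_ge0 _.
have eAC : `|A - C| <= e.
  by rewrite -ler_sqr ?nnegrE // real_normK ?num_real // e2 lerDl mulr_ge0 ?sqr_ge0.
have C0 : 0 < C.
  by rewrite -(pmulr_rgt0 _ A0); have := sqr_ge0 B; lra.
move: eAC; rewrite ler_norml => /andP[eAC1 eAC2].
(* Solving for the focal parameters: [a2] is the larger eigenvalue of [[[A, B], [B, C]]], then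
   [d1^2 = a2 - C] and [d2^2 = a2 - A], with the sign of [d2] chosen to match [B]. *)
set a2 := (A + C + e) / 2.
have aA : 0 <= a2 - A by rewrite /a2; lra.
have aC : 0 <= a2 - C by rewrite /a2; lra.
have prod : (a2 - A) * (a2 - C) = B ^+ 2 by rewrite /a2; lra.
set d1 := Num.sqrt (a2 - C); set d2 := (if 0 <= B then 1 else -1) * Num.sqrt (a2 - A).
have d12 : d1 ^+ 2 = a2 - C by rewrite sqr_sqrtr.
have d22 : d2 ^+ 2 = a2 - A.
  by rewrite exprMn sqr_sqrtr //; case: ifP => _; rewrite ?sqrrN expr1n mul1r.
have dB : d1 * d2 = B.
  rewrite mulrCA -sqrtrM // mulrC [_ * (a2 - A)]mulrC prod sqrtr_sqr.
  case: ifPn => B0; first by rewrite mulr1 ger0_norm.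
  by rewrite -ltNge in B0; rewrite ltr0_norm // mulrN1 opprK.
have a0 : 0 < a2 by rewrite /a2; lra.
set a := Num.sqrt a2; have aE : a ^+ 2 = a2 by rewrite sqr_sqrtr // ltW.
have da : `|d1 +i* d2| < a%:C.
  rewrite normc_def ltcR ltr_sqrt //= d12 d22.
  have : A * C - B ^+ 2 = a2 * (A + C - a2) by rewrite -prod; ring.
  move=> H; move: D0; rewrite H pmulr_rgt0 //; lra.
exists (c + (d1 +i* d2)), (c - (d1 +i* d2)), a; split.
- have -> : c + (d1 +i* d2) - (c - (d1 +i* d2)) = 2 * (d1 +i* d2) by ring.
  by rewrite normrM [`|2|]ger0_norm ?ler0n // rmorphM /= rmorph_nat ltr_pM2l ?ltr0n.
- by field.
- by rewrite focal_ellipseE //= aE d12 d22 dB; congr centered_ellipse; ring.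
Qed.

Lemma convex_set_horizontal (R : realType) (S : set R[i]) (x1 x2 x y : R) :
  @convex_set R (Rcomplex R) S -> S (x1 +i* y) -> S (x2 +i* y) ->
  x1 <= x <= x2 -> S (x +i* y).
Proof.
move=> /convex_setP Scvx S1 S2 /andP[x1x xx2].
have [x12|x12] := eqVneq x1 x2.
  by rewrite (_ : x = x1) //; apply/eqP; rewrite eq_le x1x andbT x12.
have d0 : 0 < x2 - x1 by rewrite subr_gt0 lt_neqAle x12 (le_trans x1x).
have -> : x +i* y = ((x2 - x) / (x2 - x1))%:C * (x1 +i* y)
    + (1 - (x2 - x) / (x2 - x1))%:C * (x2 +i* y).
  by congr (_ +i* _) => /=; field; rewrite gt_eqF.
apply: Scvx => //; apply/andP; split.
  by rewrite divr_ge0 ?subr_ge0 // (le_trans x1x).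
by rewrite ler_pdivrMr // mul1r lerD2l lerN2.
Qed.

Lemma support_sq_gt0 (R : realType) (A B C c s : R) : 0 < A -> 0 < A * C - B ^+ 2 ->
  (c, s) != (0, 0) -> 0 < support_sq A B C c s.
Proof.
move=> A0 D0 cs0; rewrite -(pmulr_rgt0 _ A0).
rewrite [ltRHS](_ : _ = (A * c + B * s) ^+ 2 + (A * C - B ^+ 2) * s ^+ 2); last first.
  by rewrite /support_sq; ring.
have [s0|s0] := eqVneq s 0.
  move: cs0; rewrite s0 expr0n mulr0 !addr0 xpair_eqE eqxx andbT => c0.
  by rewrite mulr0 addr0 exprn_even_gt0 //= mulf_neq0 // gt_eqF.
apply: ltr_wpDl; first exact: sqr_ge0.
by apply: mulr_gt0 => //; rewrite exprn_even_gt0.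
Qed.

Lemma support_sq_ge0 (R : realType) (A B C c s : R) : 0 < A -> 0 < A * C - B ^+ 2 ->
  0 <= support_sq A B C c s.
Proof.
move=> A0 D0; have [[-> ->]|cs0] := eqVneq (c, s) (0, 0).
  by rewrite /support_sq expr0n /= !mulr0 !addr0.
exact/ltW/support_sq_gt0.
Qed.

(** Cauchy-Schwarz for a quadratic form and its adjugate, with the defect as an explicit square. *)
Lemma support_adjE (R : realType) (A B C c s x y : R) :
  support_sq A B C c s * adj_form A B C x y =
  (A * C - B ^+ 2) * (c * x + s * y) ^+ 2
  + (c * (A * y - B * x) - s * (C * x - B * y)) ^+ 2.
Proof. by rewrite /support_sq /adj_form; ring. Qed.

Lemma adj_form_le (R : realType) (A B C c s x y : R) : 0 < A -> 0 < A * C - B ^+ 2 ->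
  adj_form A B C x y <= A * C - B ^+ 2 ->
  c * x + s * y <= Num.sqrt (support_sq A B C c s).
Proof.
move=> A0 D0 xyD; have q0 := support_sq_ge0 c s A0 D0.
apply: le_trans (ler_norm _) _; rewrite -ler_sqr ?nnegrE ?sqrtr_ge0 //.
rewrite real_normK ?num_real // sqr_sqrtr // -(ler_pM2l D0).
have := support_adjE A B C c s x y; have := ler_wpM2l q0 xyD.
by have := sqr_ge0 (c * (A * y - B * x) - s * (C * x - B * y)); lra.
Qed.

(** It suffices to test the normal to the level curve through [(x, y)], where the inequality reads
    [G <= sqrt (D G)]. *)
Lemma adj_form_leP (R : realType) (A B C x y : R) : 0 < A -> 0 < A * C - B ^+ 2 ->
  (forall c s, c * x + s * y <= Num.sqrt (support_sq A B C c s)) ->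
  adj_form A B C x y <= A * C - B ^+ 2.
Proof.
move=> A0 D0 /(_ (C * x - B * y) (A * y - B * x)).
set D := _ - _ in D0 *; set G := adj_form A B C x y.
have -> : support_sq A B C (C * x - B * y) (A * y - B * x) = D * G.
  by rewrite /support_sq /D /G /adj_form; ring.
have -> : (C * x - B * y) * x + (A * y - B * x) * y = G by rewrite /G /adj_form; ring.
have [G0|G0] := leP G 0; first by move=> _; apply: le_trans G0 _; apply: ltW.
rewrite -ler_sqr ?nnegrE ?sqrtr_ge0 ?(ltW G0) // sqr_sqrtr ?mulr_ge0 ?(ltW G0) ?(ltW D0) //.
by rewrite expr2 ler_pM2r.
Qed.

(** The contact point is the gradient of the square root of the support form. *)
Lemma adj_form_support_point (R : realType) (A B C c s : R) :
  0 < A -> 0 < A * C - B ^+ 2 -> (c, s) != (0, 0) ->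
  let r := Num.sqrt (support_sq A B C c s) in
  let x := (A * c + B * s) / r in let y := (B * c + C * s) / r in
  adj_form A B C x y = A * C - B ^+ 2 /\ c * x + s * y = r.
Proof.
move=> A0 D0 cs0 r x y.
have q0 := support_sq_gt0 A0 D0 cs0; have r0 : r != 0 by rewrite gt_eqF // sqrtr_gt0.
have r2 : r ^+ 2 = support_sq A B C c s by rewrite sqr_sqrtr // ltW.
split.
  have -> : adj_form A B C x y = (A * C - B ^+ 2) * support_sq A B C c s / r ^+ 2.
    by rewrite /adj_form /support_sq /x /y; field.
  by rewrite -r2 mulfK // expf_neq0.
have -> : c * x + s * y = support_sq A B C c s / r.
  by rewrite /support_sq /x /y; field.
by rewrite -r2 expr2 mulfK.
Qed.

Lemma in_half_plane_ellipse (R : realType) (A B C : R) (z0 : R[i]) (c s m : R) :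
  0 < A -> 0 < A * C - B ^+ 2 ->
  in_half_plane (centered_ellipse A B C z0) c s m <->
  c * complex.Re z0 + s * complex.Im z0 + Num.sqrt (support_sq A B C c s) <= m.
Proof.
move=> A0 D0; split=> [Em|m_ge [x y] /= Exy]; last first.
  apply: le_trans m_ge.
  have /(adj_form_le c s A0 D0) : adj_form A B C (x - complex.Re z0) (y - complex.Im z0)
      <= A * C - B ^+ 2 by rewrite Exy.
  by lra.
have at_point (x y : R) : adj_form A B C x y = A * C - B ^+ 2 ->
    c * (complex.Re z0 + x) + s * (complex.Im z0 + y) <= m.
  move=> xyD; apply: (Em ((complex.Re z0 + x) +i* (complex.Im z0 + y))).
  by rewrite /centered_ellipse /= ![_ + _ - _]addrAC !subrr !add0r.
have [[c0 s0]|cs0] := eqVneq (c, s) (0, 0).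
  have n0 : (1, 0) != (0, 0) :> R * R by rewrite xpair_eqE oner_eq0.
  have [xyD _] := adj_form_support_point A0 D0 n0.
  have -> : support_sq A B C c s = 0 by rewrite c0 s0 /support_sq; ring.
  by have := at_point _ _ xyD; rewrite c0 s0 sqrtr0 !mul0r !addr0.
have /= [] := adj_form_support_point A0 D0 cs0.
move: (_ / _) (_ / _) => x y xyD xyE.
by have := at_point _ _ xyD; lra.
Qed.

(** The horizontal chord through the point ends on the ellipse; completing the square,
    [C * adj_form] is [(C u - B t)^2 + D t^2], which gives the two ends. *)
Lemma adj_form_le_hull (R : realType) (A B C : R) (z0 z : R[i]) :
  0 < A -> 0 < A * C - B ^+ 2 ->
  adj_form A B C (complex.Re z - complex.Re z0) (complex.Im z - complex.Im z0)
    <= A * C - B ^+ 2 ->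
  convex_hull (centered_ellipse A B C z0) z.
Proof.
case: z0 z => [x0 y0] [x y] /= A0 D0.
set D := A * C - B ^+ 2 in D0 *; move=> wD.
have C0 : 0 < C by rewrite -(pmulr_rgt0 _ A0); have := sqr_ge0 B; rewrite /D in D0; lra.
have adjC (u t : R) : C * adj_form A B C u t = (C * u - B * t) ^+ 2 + D * t ^+ 2.
  by rewrite /adj_form /D; ring.
have CwD : (C * (x - x0) - B * (y - y0)) ^+ 2 <= D * (C - (y - y0) ^+ 2).
  by have := adjC (x - x0) (y - y0); have := ler_wpM2l (ltW C0) wD; lra.
set r := Num.sqrt (D * (C - (y - y0) ^+ 2)).
have r2 : r ^+ 2 = D * (C - (y - y0) ^+ 2) by rewrite sqr_sqrtr // (le_trans (sqr_ge0 _) CwD).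
have : `|C * (x - x0) - B * (y - y0)| <= r.
  by rewrite -ler_sqr ?nnegrE ?sqrtr_ge0 // real_normK ?num_real // r2.
rewrite ler_norml => /andP[lo hi].
apply: (@convex_set_horizontal _ _ (x0 + (B * (y - y0) - r) / C) (x0 + (B * (y - y0) + r) / C)).
- exact: convex_hull_convex.
- apply: sub_convex_hull; rewrite /centered_ellipse /= -/D.
  apply: (mulfI (lt0r_neq0 C0)); rewrite adjC.
  have -> : C * (x0 + (B * (y - y0) - r) / C - x0) - B * (y - y0) = - r by field; rewrite gt_eqF.
  by rewrite sqrrN r2; ring.
- apply: sub_convex_hull; rewrite /centered_ellipse /= -/D.
  apply: (mulfI (lt0r_neq0 C0)); rewrite adjC.
  have -> : C * (x0 + (B * (y - y0) + r) / C - x0) - B * (y - y0) = r by field; rewrite gt_eqF.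
  by rewrite r2; ring.
rewrite -!lerBrDl ler_pdivrMr // -lerBlDl ler_pdivlMr //; apply/andP; split; lra.
Qed.

(** * Sufficiency *)

(* [W] has the support function [d * |c| + sqrt q] of the convex hull of the two
   translates by [d] and [- d] of the ellipse of support function [sqrt q]; the last
   clause says that the end points of the two horizontal edges belong to [W]. *)
Definition stadium_support {R : realType} (A B C d : R) (W : set R[i]) : Prop :=
  [/\ forall c s, in_half_plane W c s (d * `|c| + Num.sqrt (support_sq A B C c s)),
      forall c s, exists2 z, W z &
        c * complex.Re z + s * complex.Im z = d * `|c| + Num.sqrt (support_sq A B C c s)
    & forall s, C * s ^+ 2 = 1 -> W ((d + B * s) +i* (C * s)) /\ W ((- d + B * s) +i* (C * s))].

(** By this central symmetry only the right-hand arc needs study. *)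
Lemma stadium_support_opp (R : realType) (A B C d : R) (W : set R[i]) :
  stadium_support A B C d W -> stadium_support A B C d [set z | W (- z)]%classic.
Proof.
have qN c s : support_sq A B C (- c) (- s) = support_sq A B C c s.
  by rewrite /support_sq; ring.
move=> [le_h att edge]; split.
- move=> c s [x y] Wz; have := le_h (- c) (- s) _ Wz.
  by rewrite qN normrN /= !mulrNN.
- move=> c s; have [[x y] Wz zE] := att (- c) (- s).
  exists (- (x +i* y)); first by rewrite /= opprK.
  by move: zE; rewrite qN normrN /= !mulNr !mulrN.
- move=> s s1; have [|W1 W2] := edge (- s); first by rewrite sqrrN.
  have oppE (u : R) : - ((u + B * s) +i* (C * s)) = (- u + B * - s) +i* (C * - s).
    by congr (_ +i* _); ring.
  by rewrite /mkset !oppE opprK.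
Qed.

(** When the support form [q] is 1 at [(c, s)], the point [(d + A c + B s, B c + C s)] is where the
    right ellipse touches its support line. So the arc bounds the region on the right at every
    height. *)
Lemma stadium_right_chord (R : realType) (A B C d x y : R) :
  0 < A -> 0 < A * C - B ^+ 2 ->
  (forall c s, c * x + s * y <= d * `|c| + Num.sqrt (support_sq A B C c s)) ->
  exists c s, [/\ 0 <= c, support_sq A B C c s = 1, y = B * c + C * s
    & x <= d + A * c + B * s].
Proof.
move=> A0 D0 le_h; set D := A * C - B ^+ 2 in D0.
have C0 : 0 < C by rewrite -(pmulr_rgt0 _ A0); have := sqr_ge0 B; rewrite /D in D0; lra.
have yC : y ^+ 2 <= C.
  have qC (s : R) : s ^+ 2 = 1 -> support_sq A B C 0 s = C.
    by move=> s1; rewrite /support_sq s1; ring.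
  rewrite -[leRHS]sqr_sqrtr ?(ltW C0) // -[leLHS]real_normK ?num_real //.
  rewrite ler_sqr ?nnegrE ?sqrtr_ge0 // ler_norml.
  have := le_h 0 (-1); have := le_h 0 1; rewrite normr0 !qC ?sqrrN ?expr1n //.
  by lra.
(* Solved from [C q = (B c + C s)^2 + D c^2] with [q = 1] and [B c + C s = y]. *)
set c := Num.sqrt ((C - y ^+ 2) / D).
have c0 : 0 <= c := sqrtr_ge0 _.
have c2 : D * c ^+ 2 = C - y ^+ 2.
  rewrite /c sqr_sqrtr; first by field; rewrite gt_eqF.
  by apply: divr_ge0; [rewrite subr_ge0|exact: ltW].
set s := (y - B * c) / C.
have yE : y = B * c + C * s by rewrite /s; field; rewrite gt_eqF.
have q1 : support_sq A B C c s = 1.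
  apply: (mulfI (lt0r_neq0 C0)); rewrite mulr1.
  have -> : C * support_sq A B C c s = (B * c + C * s) ^+ 2 + D * c ^+ 2.
    by rewrite /support_sq /D; ring.
  by rewrite -yE c2; ring.
exists c, s; split=> //.
have qE : c * (A * c + B * s) + s * y = 1 by rewrite -q1 yE /support_sq; ring.
have [c00|c_gt0] := eqVneq c 0; last first.
  have {}c_gt0 : 0 < c by rewrite lt_def c_gt0.
  rewrite -(ler_pM2l c_gt0); have := le_h c s; rewrite q1 sqrtr1 ger0_norm //; lra.
(* At the extreme heights [c = 0], and the direction [(0, s)] does not constrain [x]. Tilting it to
   [(r, s)] with [r = k / A] and using [sqrt (1 + 2 u) <= 1 + u] yields [r k <= r k / 2], absurd for
   an excess [k > 0]. *)
rewrite c00 mulr0 addr0 leNgt; apply/negP => x_gt.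
set k := x - (d + B * s); have k0 : 0 < k by rewrite subr_gt0.
set r := k / A; have r0 : 0 < r by rewrite divr_gt0.
have rA : A * r = k by rewrite /r mulrC divfK // gt_eqF.
have q_r : support_sq A B C r s = 1 + 2 * (r * (B * s) + r * k / 2).
  transitivity (support_sq A B C c s + 2 * (r * (B * s) + r * k / 2)); last by rewrite q1.
  by rewrite -rA c00 /support_sq; field.
have t0 := support_sq_ge0 r s A0 D0.
have sq_le : Num.sqrt (support_sq A B C r s) <= 1 + (r * (B * s) + r * k / 2).
  have t1 : 0 <= 1 + (r * (B * s) + r * k / 2) by rewrite q_r in t0; lra.
  rewrite -ler_sqr ?nnegrE ?sqrtr_ge0 // sqr_sqrtr // q_r.
  by have := sqr_ge0 (r * (B * s) + r * k / 2); lra.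
have := le_h r s; rewrite (ger0_norm (ltW r0)) => le_r.
have rk : 0 < r * k by rewrite mulr_gt0.
have : r * x + s * y <= d * r + (1 + (r * (B * s) + r * k / 2)).
  by apply: le_trans le_r _; rewrite lerD2l.
have -> : x = k + (d + B * s) by rewrite /k; ring.
by move: qE; rewrite c00; lra.
Qed.

(** For [c > 0] some point of [W] attains the support value; the arc point at its height is no
    further left, and strict convexity of the ellipse identifies the two. For [c = 0] the clause on
    edges applies. *)
Lemma stadium_right_arc (R : realType) (A B C d c s : R) (W : set R[i]) :
  0 < A -> 0 < A * C - B ^+ 2 -> stadium_support A B C d W ->
  0 <= c -> support_sq A B C c s = 1 ->
  W ((d + A * c + B * s) +i* (B * c + C * s)).
Proof.
move=> A0 D0 [le_h att edge] c0 q1.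
have [c00|c_neq0] := eqVneq c 0.
  have [] := edge s; first by rewrite -q1 c00 /support_sq; ring.
  by rewrite c00 !mulr0 addr0 add0r.
have c_gt0 : 0 < c by rewrite lt_def c_neq0.
have [[x y] Wz /= zE] := att c s; rewrite q1 sqrtr1 ger0_norm // in zE.
have [c' [s' [c'0 q1' yE xle]]] :=
  @stadium_right_chord _ A B C d x y A0 D0 (fun c s => le_h c s _ Wz).
have {}xle := ler_wpM2l c0 xle.
(* Otherwise [q (c - c', s - s') > 0]; but this is [2 - 2 (c (A c' + B s') + s y)], at most 0 since
   [c x + s y = d c + 1]. *)
have /andP[/eqP cE /eqP sE] : (c - c' == 0) && (s - s' == 0).
  apply: contraT => ne.
  have : 0 < support_sq A B C (c - c') (s - s') by apply: support_sq_gt0; rewrite ?xpair_eqE.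
  have -> : support_sq A B C (c - c') (s - s') = support_sq A B C c s + support_sq A B C c' s'
      - 2 * (c * (A * c' + B * s') + s * (B * c' + C * s')) by rewrite /support_sq; ring.
  by rewrite q1 q1' -yE; lra.
have {}cE : c' = c by lra.
have {}sE : s' = s by lra.
rewrite cE sE in yE; rewrite -yE (_ : d + _ + _ = x) //.
apply: (mulfI c_neq0); rewrite -[RHS](addrK (s * y)) zE yE.
transitivity (d * c + support_sq A B C c s - s * (B * c + C * s)); last by rewrite q1.
by rewrite /support_sq; ring.
Qed.

(** Points of [W] and of the hull obey the same support inequalities, so each lies on a horizontal
    segment between the left and right arcs; both sets are convex and contain these arcs. *)
Lemma stadium_support_hull (R : realType) (A B C d : R) (W : set R[i]) :
  0 < A -> 0 < A * C - B ^+ 2 -> 0 <= d ->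
  @convex_set R (Rcomplex R) W -> stadium_support A B C d W ->
  W = convex_hull (centered_ellipse A B C d%:C `|` centered_ellipse A B C (- d%:C))%classic.
Proof.
move=> A0 D0 d0 Wcvx WS; have WSN := stadium_support_opp WS.
have right_arc c s : 0 <= c -> support_sq A B C c s = 1 ->
    centered_ellipse A B C d%:C ((d + A * c + B * s) +i* (B * c + C * s)) /\
    centered_ellipse A B C (- d%:C) (- ((d + A * c + B * s) +i* (B * c + C * s))).
  move=> c0 q1; rewrite /centered_ellipse /= oppr0 !subr0.
  have qE : adj_form A B C (A * c + B * s) (B * c + C * s)
      = (A * C - B ^+ 2) * support_sq A B C c s by rewrite /adj_form /support_sq; ring.
  rewrite q1 mulr1 in qE.
  by split; rewrite -qE /adj_form; ring.
have chord z : (forall c s, c * complex.Re z + s * complex.Im z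
    <= d * `|c| + Num.sqrt (support_sq A B C c s)) ->
    exists c s c' s', [/\ 0 <= c, support_sq A B C c s = 1, 0 <= c',
      support_sq A B C c' s' = 1 &
      [/\ complex.Im z = B * c + C * s, complex.Im z = - (B * c' + C * s') &
        - (d + A * c' + B * s') <= complex.Re z <= d + A * c + B * s]].
  move=> zh.
  have [c [s [c0 q1 yE xle]]] := stadium_right_chord A0 D0 zh.
  have zhN c1 s1 : c1 * - complex.Re z + s1 * - complex.Im z
      <= d * `|c1| + Num.sqrt (support_sq A B C c1 s1).
    have := zh (- c1) (- s1); rewrite normrN !mulNr !mulrN.
    by rewrite (_ : support_sq _ _ _ (- c1) _ = support_sq A B C c1 s1) // /support_sq; ring.
  have [c' [s' [c0' q1' yE' xle']]] := stadium_right_chord A0 D0 zhN.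
  by exists c, s, c', s'; do 2 split=> //; rewrite ?xle ?andbT; lra.
have le_h := let: And3 le_h _ _ := WS in le_h.
apply/seteqP; split=> [z Wz|].
  have [c [s [c' [s' [c0 q1 c0' q1' [yE yE' xle]]]]]] := chord z (fun c s => le_h c s z Wz).
  case: z {Wz} yE yE' xle => x y /= yE yE' xle.
  apply: convex_set_horizontal xle; first exact: convex_hull_convex.
    apply: sub_convex_hull; right; have [_] := right_arc _ _ c0' q1'.
    by rewrite [X in centered_ellipse _ _ _ _ X](_ : _ = - (d + A * c' + B * s') +i* y) // yE'.
  by apply: sub_convex_hull; left; have [] := right_arc _ _ c0 q1; rewrite -yE.
apply: convex_hull_min => // z Ez.
have zh c s : c * complex.Re z + s * complex.Im z
    <= d * `|c| + Num.sqrt (support_sq A B C c s).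
  have cd : `|c * d| = d * `|c| by rewrite normrM mulrC ger0_norm.
  have cd1 := ler_norm (c * d); have cd2 := ler_norm (- (c * d)); rewrite normrN in cd2.
  case: Ez => Ez; move: z Ez; apply/in_half_plane_ellipse => //=; lra.
have [c [s [c' [s' [c0 q1 c0' q1' [yE yE' xle]]]]]] := chord z zh.
case: z {Ez zh} yE yE' xle => x y /= yE yE' xle.
apply: convex_set_horizontal Wcvx _ _ xle.
  have := stadium_right_arc A0 D0 WSN c0' q1'.
  by rewrite /= yE'; apply.
by rewrite yE; apply: stadium_right_arc.
Qed.

(** With [n1], [n2] the diagonal entries of [M^* M] and [m = (n1 - n2) / 2], the top eigenvalue is
    [(n1 + n2) / 2 + sqrt (m^2 + c^2 b^2 n1)]. The hypotheses turn the root into [|c| b sqrt q], and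
    adding [(v s)^2] gives the square of [b |c| / 2 + sqrt q]. *)
Lemma mxA_stadium (R : realType) (v : R) (b1 b2 : R[i]) (b : R) :
  let e1 := complex.Im b1 in let e2 := complex.Im b2 in
  0 < b -> dotc b1 b1 = dotc b2 b2 -> v ^+ 2 * b ^+ 2 = (e1 - e2) ^+ 2 ->
  let A := b ^+ 2 / 4 + dotc b1 b1 in let B := (e1 + e2) / 2 in let C := 1 + v ^+ 2 in
  [/\ 0 < A, 0 < A * C - B ^+ 2
    & stadium_support A B C (b / 2) (numerical_range (mxA v b1 b2 b))].
Proof.
case: b1 b2 => [u1 e1] [u2 e2]; rewrite /dotc /=; set be := u1 * u1 + e1 * e1.
move=> b0 beE vbE; set A := _ + be; set B := _ / 2; set C := 1 + _.
have b2_gt0 : 0 < b ^+ 2 by rewrite exprn_gt0.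
have be0 : 0 <= be by rewrite /be -!expr2 addr_ge0 ?sqr_ge0.
have v20 := sqr_ge0 v.
have A0 : 0 < A by rewrite /A; lra.
have D0 : 0 < A * C - B ^+ 2.
  have H1 := mulr_ge0 be0 v20; have H2 := sqr_ge0 u1; have H3 := sqr_ge0 u2.
  have -> : A * C - B ^+ 2
      = b ^+ 2 / 4 + v ^+ 2 * b ^+ 2 / 4 + be / 2 + be / 2 + be * v ^+ 2 - B ^+ 2.
    by rewrite /A /C; field.
  have H4 := sqr_ge0 (e1 - e2); have beE1 : be = u1 * u1 + e1 * e1 by [].
  by rewrite vbE /B; lra.
split=> //.
have attained c s : in_half_plane (numerical_range (mxA v (u1 +i* e1) (u2 +i* e2) b)) c s
      (b / 2 * `|c| + Num.sqrt (support_sq A B C c s)) /\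
    exists2 z, numerical_range (mxA v (u1 +i* e1) (u2 +i* e2) b) z &
      c * complex.Re z + s * complex.Im z
        = b / 2 * `|c| + Num.sqrt (support_sq A B C c s).
  have q0 := support_sq_ge0 c s A0 D0.
  set r := Num.sqrt _; have r2 : r ^+ 2 = support_sq A B C c s by rewrite sqr_sqrtr.
  have r0 : 0 <= r := sqrtr_ge0 _.
  have c0 := normr_ge0 c; have c2 : `|c| ^+ 2 = c ^+ 2 by rewrite real_normK ?num_real.
  apply: numerical_range_support.
    by rewrite addr_ge0 // mulr_ge0 // divr_ge0 // ltW.
  set n1 := (c * u1) ^+ 2 + (c * e1 + s) ^+ 2.
  set n2 := (c * b) ^+ 2 + (c * u2) ^+ 2 + (c * e2 + s) ^+ 2.
  set m := (n1 - n2) / 2.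
  have mE : m = (2 * (c * s) * (e1 - e2) - c ^+ 2 * b ^+ 2) / 2.
    have -> : m = (c ^+ 2 * (be - (u2 * u2 + e2 * e2))
        + 2 * (c * s) * (e1 - e2) - c ^+ 2 * b ^+ 2) / 2.
      by rewrite /m /n1 /n2 /be; field.
    by rewrite -beE subrr mulr0 add0r.
  have lE : (b / 2 * `|c| + r) ^+ 2 - (v * s) ^+ 2 = (n1 + n2) / 2 + `|c| * b * r.
    have -> : (b / 2 * `|c| + r) ^+ 2 - (v * s) ^+ 2
        = b ^+ 2 / 4 * `|c| ^+ 2 + r ^+ 2 - (v * s) ^+ 2 + `|c| * b * r by field.
    rewrite c2 r2; congr (_ + _).
    have -> : (n1 + n2) / 2 = c ^+ 2 * (be + (u2 * u2 + e2 * e2)) / 2 + (c * b) ^+ 2 / 2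
        + c * s * (e1 + e2) + s ^+ 2 by rewrite /n1 /n2 /be; field.
    by rewrite -beE /support_sq /A /B /C; field.
  have prod : (`|c| * b * r) ^+ 2 - m ^+ 2 = (c * b) ^+ 2 * n1.
    have -> : (`|c| * b * r) ^+ 2 = `|c| ^+ 2 * b ^+ 2 * r ^+ 2 by ring.
    rewrite c2 r2 mE.
    have -> : c ^+ 2 * b ^+ 2 * support_sq A B C c s = c ^+ 2 * b ^+ 2 * (support_sq A B 1 c s)
       + c ^+ 2 * (v ^+ 2 * b ^+ 2) * s ^+ 2 by rewrite /support_sq /C; ring.
    by rewrite vbE /support_sq /A /B /n1 /be; field.
  have cbr0 : 0 <= `|c| * b * r by rewrite !mulr_ge0 // ltW.
  have : `|m| <= `|c| * b * r.
    rewrite -ler_sqr ?nnegrE // real_normK ?num_real // -subr_ge0 prod.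
    by rewrite mulr_ge0 ?addr_ge0 ?sqr_ge0.
  rewrite ler_norml => /andP[m1 m2].
  rewrite /top_sqsingular /= lE -/n1 -/n2; split.
  - by rewrite /m in m2; lra.
  - by rewrite /m in m1; lra.
  - by rewrite -prod /m; field.
split=> [c s|c s|s s1]; first by case: (attained c s).
  by case: (attained c s).
have s0 : s != 0.
  by apply: contra_eq_neq s1 => ->; rewrite expr0n mulr0 eq_sym oner_eq0.
(* [1 + v s] is the factor [h + w] of the eigenvectors in direction [(0, s)], where [h = 1]. *)
have vs0 : 1 + v * s != 0.
  have : s ^+ 2 != 0 by rewrite expf_neq0.
  apply: contra => /eqP vs; apply/eqP.
  have : (1 + v * s) * (1 - v * s) = s ^+ 2 by move: s1; rewrite /C; lra.
  by rewrite vs mul0r.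
have edge (t : R) : t ^+ 2 = 1 ->
    numerical_range (mxA v (u1 +i* e1) (u2 +i* e2) b) ((t * (b / 2) + B * s) +i* (C * s)).
  move=> t1.
  (* In direction [(0, s)], [M = i s] is scalar and the top eigenspace consists of the vectors
     [((1 + v s) u, i s u)]. For [u = (p, i r)] the real part is, up to normalization, the form of
     [(s / 2) [[e1 - e2, b], [b, e2 - e1]] + B s]. The first summand has eigenvalues [b / 2] and
     [- b / 2], and [(p, r)] is its eigenvector for [t b / 2]. *)
  set p := s * b / 2; set r := t * b / 2 - s * (e1 - e2) / 2.
  have eig1 : s * ((e1 - e2) / 2 * p + b / 2 * r) = t * (b / 2) * p by rewrite /p /r; ring.
  have eig2 : s * (b / 2 * p - (e1 - e2) / 2 * r) = t * (b / 2) * r.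
    have -> : s * (b / 2 * p - (e1 - e2) / 2 * r)
      = s ^+ 2 * (b ^+ 2 + (e1 - e2) ^+ 2) / 4 - t * s * (e1 - e2) * b / 4 by rewrite /p /r; field.
    rewrite -vbE.
    have -> : s ^+ 2 * (b ^+ 2 + v ^+ 2 * b ^+ 2) = t ^+ 2 * (C * s ^+ 2 * b ^+ 2).
      by rewrite t1 /C; ring.
    by rewrite s1 /r; field.
  have N0 : p ^+ 2 + r ^+ 2 != 0.
    have p0 : p != 0 by rewrite /p !mulf_neq0 ?invr_eq0 ?pnatr_eq0 // gt_eqF.
    by rewrite gt_eqF // ltr_pwDl ?sqr_ge0 // exprn_even_gt0.
  have NE : sqnorm4 ((1 + v * s) * p)%:C (0 +i* ((1 + v * s) * r)) (0 +i* (s * p)) (- (s * r))%:C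
      = 2 * (1 + v * s) * (p ^+ 2 + r ^+ 2).
    rewrite /sqnorm4 /dotc /=.
    transitivity (((1 + v * s) ^+ 2 + (C * s ^+ 2 - (v * s) ^+ 2)) * (p ^+ 2 + r ^+ 2)).
      by rewrite /C; ring.
    by rewrite s1; ring.
  apply/numerical_range_mxAP.
  exists ((1 + v * s) * p)%:C, (0 +i* ((1 + v * s) * r)), (0 +i* (s * p)), (- (s * r))%:C.
  rewrite NE; split=> /=; first by rewrite !mulf_neq0 ?pnatr_eq0.
    transitivity (2 * (1 + v * s) * (p * (s * ((e1 - e2) / 2 * p + b / 2 * r))
        + r * (s * (b / 2 * p - (e1 - e2) / 2 * r)) + B * s * (p ^+ 2 + r ^+ 2))).
      by rewrite /reA /dotc /crossc /B /=; field.
    by rewrite eig1 eig2; ring.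
  transitivity (v * (((1 + v * s) ^+ 2 - (C * s ^+ 2 - (v * s) ^+ 2)) * (p ^+ 2 + r ^+ 2))
      + 2 * (1 + v * s) * s * (p ^+ 2 + r ^+ 2)).
    by rewrite /imA /dotc /crossc /C /=; ring.
  by rewrite s1 /C; ring.
split; first by have := edge 1; rewrite expr1n mul1r; apply.
by have := edge (-1); rewrite sqrrN expr1n mulN1r; apply.
Qed.

Lemma mxA_bi_elliptical (R : realType) (v : R) (b1 b2 : R[i]) (b : R) :
  0 < b -> dotc b1 b1 = dotc b2 b2 ->
  v ^+ 2 * b ^+ 2 = (complex.Im b1 - complex.Im b2) ^+ 2 ->
  bi_elliptical (numerical_range (mxA v b1 b2 b)).
Proof.
move=> b0 beE vbE; have [A0 D0 WS] := mxA_stadium b0 beE vbE.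
set A := _ + _ in A0 D0 WS; set B := _ / 2 in D0 WS; set C := 1 + _ in D0 WS.
set d := b / 2 in WS; have d0 : 0 < d by rewrite divr_gt0.
exists (centered_ellipse A B C d%:C), (centered_ellipse A B C (- d%:C)), d%:C, (- d%:C).
(* In direction [(c, 0)] the support values differ by [c (x - y)], so [c = 1] and [c = -1] would
   force equal centers. *)
have not_sub (x y : R) : x != y ->
    ~ (centered_ellipse A B C x%:C `<=` convex_hull (centered_ellipse A B C y%:C))%classic.
  move=> xy sub; have ineq c : c * x <= c * y.
    have half (m : R) : in_half_plane (centered_ellipse A B C y%:C) c 0 m ->
        in_half_plane (centered_ellipse A B C x%:C) c 0 m.
      by move=> /in_half_plane_hull Hm z /sub /Hm.
    have := half (c * y + Num.sqrt (support_sq A B C c 0)).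
    rewrite !in_half_plane_ellipse //= !mulr0 !addr0 lexx => /(_ isT).
    by rewrite lerD2r.
  by have := ineq 1; have := ineq (-1); move/eqP: xy; lra.
have dN : - d%:C = (- d)%:C :> R[i] by rewrite rmorphN.
split.
- by split; apply: centered_ellipse_is_ellipse.
- by rewrite dN => /complexI; lra.
- by rewrite dN; apply: not_sub; apply/eqP; lra.
- by rewrite dN; apply: not_sub; apply/eqP; lra.
- exact: (stadium_support_hull A0 D0 (ltW d0) (@numerical_range_convex _ _ _) WS).
Qed.

(** * Necessity *)

Lemma poly_eq_on_interval (R : realType) (p1 p2 : {poly R}) (t0 t1 : R) : t0 < t1 ->
  (forall t, t0 <= t < t1 -> p1.[t] = p2.[t]) -> p1 = p2.
Proof.
move=> t01 eq12; apply/eqP; rewrite -subr_eq0; apply: contraT => p0.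
set p := p1 - p2 in p0; set n := size p.
have n0 : 0 < (n.+1)%:R :> R by rewrite ltr0n.
have d0 : 0 < (t1 - t0) / (n.+1)%:R by rewrite divr_gt0 ?subr_gt0.
pose s := mkseq (fun i => t0 + (t1 - t0) / (n.+1)%:R * i%:R) n.
have s_uniq : uniq s.
  apply: mkseq_uniq => i j /addrI /(mulfI (lt0r_neq0 d0)) /eqP.
  by rewrite eqr_nat => /eqP.
have s_root : all (root p) s.
  apply/(all_nthP 0) => i; rewrite size_mkseq => i_n; rewrite nth_mkseq //.
  rewrite rootE hornerD hornerN subr_eq0 eq12 // lerDl mulr_ge0 ?(ltW d0) //=.
  rewrite -ltrBrDl mulrAC ltr_pdivrMr // ltr_pM2l ?subr_gt0 // ltr_nat.
  exact: ltn_trans i_n _.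
by have := max_poly_roots p0 s_root s_uniq; rewrite size_mkseq ltnn.
Qed.

Definition poly2 {R : realType} (a0 a1 a2 : R) : {poly R} :=
  a0%:P + a1%:P * 'X + a2%:P * 'X^2.

Lemma poly2E (R : realType) (a0 a1 a2 t : R) :
  (poly2 a0 a1 a2).[t] = a0 + a1 * t + a2 * t ^+ 2.
Proof. by rewrite !hornerE. Qed.

Lemma poly2_coef (R : realType) (a0 a1 a2 : R) :
  [/\ (poly2 a0 a1 a2)`_0 = a0, (poly2 a0 a1 a2)`_1 = a1 & (poly2 a0 a1 a2)`_2 = a2].
Proof.
rewrite /poly2 !coefD !coefCM !coefC !coefX !coefXn /=.
by split; rewrite !(mulr0, mulr1, addr0, add0r).
Qed.

Lemma poly2_inj (R : realType) (a0 a1 a2 c0 c1 c2 : R) :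
  poly2 a0 a1 a2 = poly2 c0 c1 c2 -> [/\ a0 = c0, a1 = c1 & a2 = c2].
Proof.
move=> E; have [E0 E1 E2] := poly2_coef a0 a1 a2; have [F0 F1 F2] := poly2_coef c0 c1 c2.
by rewrite E in E0 E1 E2; rewrite -E0 -E1 -E2.
Qed.

Lemma size_poly2 (R : realType) (a0 a1 a2 : R) : (size (poly2 a0 a1 a2) <= 3)%N.
Proof.
apply/leq_sizeP => j j3; rewrite /poly2 !coefD !coefCM coefC coefX coefXn.
by case: j j3 => [|[|[|j]]] //= _; rewrite !mulr0 !addr0.
Qed.

Lemma poly2_dvd (R : realType) (a0 a1 a2 : R) (p : {poly R}) : a2 != 0 ->
  (size p <= 3)%N -> poly2 a0 a1 a2 %| p -> exists k, p = k%:P * poly2 a0 a1 a2.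
Proof.
move=> a2_neq0 p3 /dvdpP[g pE].
have q0 : poly2 a0 a1 a2 != 0.
  by apply: contra_neq a2_neq0 => q0; have [_ _ <-] := poly2_coef a0 a1 a2; rewrite q0 coef0.
have q3 : (2 < size (poly2 a0 a1 a2))%N.
  rewrite ltnNge; apply: contra a2_neq0 => /leq_sizeP/(_ _ (leqnn 2)).
  by have [_ _ ->] := poly2_coef a0 a1 a2 => ->.
have [g0|g0] := eqVneq g 0; first by exists 0; rewrite pE g0 !mul0r.
have g1 : (size g <= 1)%N.
  have : ((size g + 3).-1 <= 3)%N.
    by apply: leq_trans p3; rewrite pE size_mul // -!subn1 leq_sub2r // leq_add2l.
  by rewrite addn3.
by exists g`_0; rewrite pE {1}(size1_polyC g1).
Qed.

Lemma poly2_irreducible (R : realType) (A B C : R) : 0 < A -> 0 < A * C - B ^+ 2 ->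
  irreducible_poly (poly2 A (2 * B) C).
Proof.
move=> A0 D0.
have C0 : C != 0 by apply: contraTneq D0 => ->; rewrite mulr0 sub0r -leNgt oppr_le0 sqr_ge0.
apply: cubic_irreducible.
  rewrite (leq_trans (size_poly2 _ _ _)) // andbT ltnNge.
  apply: contra C0 => /(leq_trans)/(_ (isT : (1 <= 2)%N)) /leq_sizeP/(_ _ (leqnn 2)).
  by have [_ _ ->] := poly2_coef A (2 * B) C => ->.
move=> t; rewrite rootE poly2E gt_eqF //.
have := @support_sq_gt0 _ A B C 1 t A0 D0 _.
rewrite /support_sq expr1n !mulr1; apply.
by rewrite xpair_eqE oner_eq0.
Qed.

Lemma irreducible_dvd_mul (F : fieldType) (q p1 p2 : {poly F}) :
  irreducible_poly q -> q %| p1 * p2 -> (q %| p1) || (q %| p2).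
Proof.
move=> qI q12; case: (boolP (q %| p1)) => //= q1.
by move: q12; rewrite Gauss_dvdpr // irreducible_poly_coprime.
Qed.

(* Squaring twice gives the polynomial identity (4 l^2 q + k - g^2)^2 = 16 l^2 q k with
   g = t - l^2 - q. As q is irreducible it divides k - g^2, and then k; so sqrt k is a
   multiple of sqrt q, and irrationality of sqrt q forces g = 0 and l constant. *)
Lemma sqrt_sum_identity (R : realType) (A B C x y k0 k1 k2 t0 t1 t2 a b : R) :
  0 < A -> 0 < A * C - B ^+ 2 -> (x, y) != (0, 0) -> a < b ->
  (forall t, 0 <= k0 + k1 * t + k2 * t ^+ 2) ->
  (forall t, a <= t < b ->
    (x + y * t + Num.sqrt (support_sq A B C 1 t)) ^+ 2
    = t0 + t1 * t + t2 * t ^+ 2 + Num.sqrt (k0 + k1 * t + k2 * t ^+ 2)) ->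
  y = 0 /\ [/\ k0 = 4 * x ^+ 2 * A, k1 = 4 * x ^+ 2 * (2 * B), k2 = 4 * x ^+ 2 * C &
    [/\ t0 = x ^+ 2 + A, t1 = 2 * B & t2 = C]].
Proof.
move=> A0 D0 xy0 ab k_ge0 eq_on.
have C_gt0 : 0 < C by rewrite -(pmulr_rgt0 _ A0); have := sqr_ge0 B; lra.
have C0 : C != 0 by rewrite gt_eqF.
set q := poly2 A (2 * B) C; set k := poly2 k0 k1 k2; set l := poly2 x y 0.
set g := poly2 (t0 - x ^+ 2 - A) (t1 - 2 * x * y - 2 * B) (t2 - y ^+ 2 - C).
have qI : irreducible_poly q := poly2_irreducible A0 D0.
have q0 : q != 0 := irredp_neq0 qI.
have qE t : q.[t] = support_sq A B C 1 t by rewrite poly2E /support_sq; ring.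
have qt_gt0 t : 0 < q.[t].
  by rewrite qE support_sq_gt0 // xpair_eqE oner_eq0.
have kt_ge0 t : 0 <= k.[t] by rewrite poly2E.
have lE t : l.[t] = x + y * t by rewrite poly2E mul0r addr0.
have gE t : a <= t < b -> 2 * l.[t] * Num.sqrt q.[t] - Num.sqrt k.[t] = g.[t].
  move=> tab; have := eq_on t tab; rewrite -qE sqrrD sqr_sqrtr ?(ltW (qt_gt0 t)) //.
  rewrite lE [k.[t]]poly2E [g.[t]]poly2E.
  have -> : (t0 - x ^+ 2 - A) + (t1 - 2 * x * y - 2 * B) * t + (t2 - y ^+ 2 - C) * t ^+ 2
      = t0 + t1 * t + t2 * t ^+ 2 - (x + y * t) ^+ 2 - q.[t] by rewrite [q.[t]]poly2E; ring.
  by move=> E; lra.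
have l0 : l != 0.
  apply: contra_neq xy0 => l0; have [x0 y0 _] := poly2_coef x y 0.
  by rewrite -/l l0 !coef0 in x0 y0; rewrite -x0 -y0.
have q_size : (2 < size q)%N.
  rewrite ltnNge; apply: contra C0 => /leq_sizeP/(_ _ (leqnn 2)).
  by have [_ _ ->] := poly2_coef A (2 * B) C => ->.
have l_ndvd : ~~ (q %| l).
  apply/negP => /(dvdp_leq l0); rewrite leqNgt => /negP; apply.
  apply: leq_ltn_trans q_size; apply/leq_sizeP => j j2.
  rewrite /l /poly2 !coefD !coefCM coefC coefX coefXn.
  by case: j j2 => [|[|j]] //= _; rewrite mulr0 mul0r !addr0.
have sq2 : (4 * l ^+ 2 * q + k - g ^+ 2) ^+ 2 = 16 * l ^+ 2 * q * k.
  have hornerL (p1 p2 p3 p4 : {poly R}) (t : R) : ((4 * p1 ^+ 2 * p2 + p3 - p4 ^+ 2) ^+ 2).[t]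
      = (4 * p1.[t] ^+ 2 * p2.[t] + p3.[t] - p4.[t] ^+ 2) ^+ 2.
    by rewrite -![in LHS]polyC_natr !(horner_exp, hornerD, hornerN, hornerM, hornerC).
  have hornerR (p1 p2 p3 : {poly R}) (t : R) : (16 * p1 ^+ 2 * p2 * p3).[t]
      = 16 * p1.[t] ^+ 2 * p2.[t] * p3.[t].
    by rewrite -[16]polyC_natr !(horner_exp, hornerM, hornerC).
  apply: (poly_eq_on_interval ab) => t tab; rewrite hornerL hornerR -(gE t tab).
  have := sqr_sqrtr (ltW (qt_gt0 t)); have := sqr_sqrtr (kt_ge0 t).
  move: (Num.sqrt _) (Num.sqrt _) => rk rq <- <-; ring.
(* Modulo [q], the identity [sq2] reads [(k - g^2)^2 = 0]. *)
have q_dvd_kg : q %| k - g ^+ 2.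
  have : q %| (k - g ^+ 2) * (k - g ^+ 2).
    rewrite (_ : _ * _ = q * (16 * l ^+ 2 * k - 16 * l ^+ 4 * q - 8 * l ^+ 2 * (k - g ^+ 2))).
      exact: dvdp_mulr.
    have -> : q * (16 * l ^+ 2 * k - 16 * l ^+ 4 * q - 8 * l ^+ 2 * (k - g ^+ 2))
      = 16 * l ^+ 2 * q * k - q * (16 * l ^+ 4 * q + 8 * l ^+ 2 * (k - g ^+ 2)) by ring.
    by rewrite -sq2; ring.
  by case/(irreducible_dvd_mul qI)/orP.
(* With [k - g^2 = u q], dividing [sq2] by [q] gives [16 l^2 k = q (4 l^2 + u)^2]; and [q] does not
   divide [l], of smaller degree. *)
have q_dvd_k : q %| k.
  have [u uE] := dvdpP _ _ q_dvd_kg.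
  have : q %| l ^+ 2 * k.
    have E : 16 * (l ^+ 2 * k) = q * (4 * l ^+ 2 + u) ^+ 2.
      apply: (mulfI q0).
      have -> : q * (16 * (l ^+ 2 * k)) = 16 * l ^+ 2 * q * k by ring.
      by rewrite -sq2 -addrA uE; ring.
    have -> : l ^+ 2 * k = q * ((16^-1)%:P * (4 * l ^+ 2 + u) ^+ 2).
      have inv16 : (16^-1)%:P * 16 = 1 :> {poly R}.
        by rewrite -[X in _ * X](polyC_natr R 16) -polyCM mulVf // pnatr_eq0.
      transitivity ((16^-1)%:P * (16 * (l ^+ 2 * k))); first by rewrite [RHS]mulrA inv16 mul1r.
      by rewrite E; ring.
    exact: dvdp_mulr.
  rewrite expr2 -mulrA => /(irreducible_dvd_mul qI); rewrite (negPf l_ndvd) /=.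
  by move=> /(irreducible_dvd_mul qI); rewrite (negPf l_ndvd).
have [c kE] : exists c, k = c%:P * q := poly2_dvd C0 (size_poly2 _ _ _) q_dvd_k.
have c0 : 0 <= c.
  have := kt_ge0 0; rewrite kE hornerM hornerC pmulr_lge0 //.
set r := Num.sqrt c; have r2 : r ^+ 2 = c by rewrite sqr_sqrtr.
(* Since [sqrt k = r sqrt q], the polynomial [m = 2 l - r] satisfies [m sqrt q = g] on the
   interval. *)
set m := poly2 (2 * x - r) (2 * y) 0.
have mg t : a <= t < b -> m.[t] * Num.sqrt q.[t] = g.[t].
  move=> tab; rewrite -(gE t tab) kE hornerM hornerC sqrtrM // -/r lE poly2E; ring.
have mg2 : m ^+ 2 * q = g ^+ 2.
  apply: (poly_eq_on_interval ab) => t tab.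
  by rewrite hornerM !horner_exp -(mg t tab) exprMn sqr_sqrtr // ltW.
have q_dvd_g : q %| g.
  have : q %| g * g by rewrite -expr2 -mg2 dvdp_mull.
  by case/(irreducible_dvd_mul qI)/orP.
have [e gqE] : exists e, g = e%:P * q := poly2_dvd C0 (size_poly2 _ _ _) q_dvd_g.
have mE : m ^+ 2 = (e ^+ 2)%:P * q.
  by apply: (mulIf q0); rewrite mg2 gqE polyCM; ring.
(* In [m^2 = e^2 q], [q] has degree 2 and no root: compare coefficients of [t^2] if [m] is constant,
   and evaluate at the root of [m] otherwise. *)
have e0 : e = 0.
  have [y0|y0] := eqVneq y 0.
    have := congr1 (fun p : {poly R} => p`_2) mE.
    have -> : m = (2 * x - r)%:P by rewrite /m y0 /poly2 mulr0 !mul0r !addr0.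
    rewrite -polyC_exp coefC /= coefCM; have [_ _ ->] := poly2_coef A (2 * B) C.
    by move/esym/eqP; rewrite mulf_eq0 (negPf C0) orbF sqrf_eq0 => /eqP.
  have := congr1 (fun p : {poly R} => p.[(r - 2 * x) / (2 * y)]) mE.
  have m0 : m.[(r - 2 * x) / (2 * y)] = 0 by rewrite poly2E; field.
  rewrite horner_exp m0 hornerM hornerC.
  rewrite expr0n /= => /esym/eqP; rewrite mulf_eq0 (gt_eqF (qt_gt0 _)) orbF sqrf_eq0.
  by move/eqP.
have m0 : m = 0.
  by apply/eqP; rewrite -sqrf_eq0 mE e0 expr0n /= mul0r.
have g0 : g = 0 by rewrite gqE e0 mul0r.
have [m0E m1E _] : [/\ 2 * x - r = 0, 2 * y = 0 & 0 = 0 :> R].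
  by apply: poly2_inj; rewrite -/m m0 /poly2 !mul0r !addr0.
have [g0E g1E g2E] : [/\ t0 - x ^+ 2 - A = 0, t1 - 2 * x * y - 2 * B = 0 & t2 - y ^+ 2 - C = 0].
  by apply: poly2_inj; rewrite -/g g0 /poly2 !mul0r !addr0.
have y0 : y = 0 by lra.
have cE : c = 4 * x ^+ 2 by rewrite -r2 (_ : r = 2 * x); [ring|lra].
have [k0E k1E k2E] : [/\ k0 = c * A, k1 = c * (2 * B) & k2 = c * C].
  by apply: poly2_inj; rewrite -/k kE /q /poly2 !polyCM; ring.
by rewrite y0 in g1E g2E *; rewrite -cE; do !split=> //; lra.
Qed.

(** Directions with [c != 0] are, up to scaling, a sign [e] and a slope [t]. Here
    [K = ((n1 - n2) / 2)^2 + b^2 n1] and [T = (n1 + n2) / 2 + (v t)^2] for the diagonal entries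
    [n1], [n2] of [M^* M], so [T + sqrt K] is the squared support function. *)
Lemma in_half_plane_mxA (R : realType) (v : R) (b1 b2 : R[i]) (b e t m : R) :
  let be1 := dotc b1 b1 in let be2 := dotc b2 b2 in
  let e1 := complex.Im b1 in let e2 := complex.Im b2 in
  let p := be1 - be2 - b ^+ 2 in
  let T := (be1 + be2 + b ^+ 2) / 2 + (e1 + e2) * t + (1 + v ^+ 2) * t ^+ 2 in
  let K := p ^+ 2 / 4 + b ^+ 2 * be1 + (p * (e1 - e2) + 2 * b ^+ 2 * e1) * t
    + ((e1 - e2) ^+ 2 + b ^+ 2) * t ^+ 2 in
  e ^+ 2 = 1 ->
  [/\ 0 <= K, 0 <= T + Num.sqrt K
    & in_half_plane (numerical_range (mxA v b1 b2 b)) e (e * t) m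
      <-> Num.sqrt (T + Num.sqrt K) <= m].
Proof.
case: b1 b2 => [u1 e1] [u2 e2] be1 be2 f1 f2 p T K ee.
set n1 := u1 ^+ 2 + (e1 + t) ^+ 2; set n2 := b ^+ 2 + u2 ^+ 2 + (e2 + t) ^+ 2.
have KE : K = ((n1 - n2) / 2) ^+ 2 + b ^+ 2 * n1.
  by rewrite /K /p /n1 /n2 /be1 /be2 /f1 /f2 /dotc /=; field.
have n1_ge0 : 0 <= n1 by rewrite addr_ge0 ?sqr_ge0.
have n2_ge0 : 0 <= n2 by rewrite !addr_ge0 ?sqr_ge0.
have K0 : 0 <= K by rewrite KE addr_ge0 ?sqr_ge0 // mulr_ge0 ?sqr_ge0.
have TE : T = (n1 + n2) / 2 + (v * t) ^+ 2.
  by rewrite /T /n1 /n2 /be1 /be2 /f1 /f2 /dotc /=; field.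
have T0 : 0 <= T by rewrite TE addr_ge0 ?sqr_ge0 // divr_ge0 // (addr_ge0 n1_ge0 n2_ge0).
have l0 : 0 <= T + Num.sqrt K by rewrite addr_ge0 ?sqrtr_ge0.
apply: And3 => //; set h := Num.sqrt (T + _).
have h2 : h ^+ 2 = T + Num.sqrt K by rewrite sqr_sqrtr.
have : `|(n1 - n2) / 2| <= Num.sqrt K.
  rewrite -ler_sqr ?nnegrE ?sqrtr_ge0 // real_normK ?num_real // sqr_sqrtr //.
  by rewrite KE lerDl mulr_ge0 ?sqr_ge0.
rewrite ler_norml => /andP[lo hi].
have k1E : (e * u1) ^+ 2 + (e * e1 + e * t) ^+ 2 = n1.
  by rewrite -mulrDr !exprMn ee !mul1r.
have k2E : (e * b) ^+ 2 + (e * u2) ^+ 2 + (e * e2 + e * t) ^+ 2 = n2.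
  by rewrite -mulrDr !exprMn ee !mul1r.
have [|le_h [z Wz zE]] :=
    @numerical_range_support _ v (u1 +i* e1) (u2 +i* e2) b e (e * t) h (sqrtr_ge0 _).
  have -> : h ^+ 2 - (v * (e * t)) ^+ 2 = (n1 + n2) / 2 + Num.sqrt K.
    have -> : (v * (e * t)) ^+ 2 = (v * t) ^+ 2 by rewrite mulrCA exprMn ee mul1r.
    by rewrite h2 TE; ring.
  rewrite /top_sqsingular /= k1E k2E; split; [lra|lra|].
  rewrite exprMn ee mul1r.
  have -> : b ^+ 2 * n1 = Num.sqrt K ^+ 2 - ((n1 - n2) / 2) ^+ 2.
    by rewrite sqr_sqrtr // KE; ring.
  by field.
split=> [/(_ z Wz)|hm z' Wz']; first by rewrite zE.
exact: le_trans (le_h _ Wz') hm.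
Qed.

(** Eliminating [A], [B], [C] leaves the relations [E1], [E2], [E3] in [w = 4 x^2 - b^2]; once
    [w = 0], they and [x != 0] give the conclusion. *)
Lemma coincidence_conditions (R : realType) (v be1 be2 e1 e2 b x A B C : R) :
  v != 0 -> x != 0 -> e1 ^+ 2 <= be1 -> e2 ^+ 2 <= be2 ->
  let p := be1 - be2 - b ^+ 2 in
  p ^+ 2 / 4 + b ^+ 2 * be1 = 4 * x ^+ 2 * A ->
  p * (e1 - e2) + 2 * b ^+ 2 * e1 = 4 * x ^+ 2 * (2 * B) ->
  (e1 - e2) ^+ 2 + b ^+ 2 = 4 * x ^+ 2 * C ->
  (be1 + be2 + b ^+ 2) / 2 = x ^+ 2 + A -> e1 + e2 = 2 * B -> 1 + v ^+ 2 = C ->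
  [/\ b != 0, be1 = be2 & v ^+ 2 * b ^+ 2 = (e1 - e2) ^+ 2].
Proof.
move=> v0 x0 be1_ge be2_ge p K0 K1 K2 T0 T1 T2.
set w := 4 * x ^+ 2 - b ^+ 2.
have xE : 4 * x ^+ 2 = w + b ^+ 2 by rewrite /w subrK.
have x_gt0 : 0 < 4 * x ^+ 2 by rewrite mulr_gt0 // exprn_even_gt0.
have E1 : w * (e1 + e2) = (be1 - be2) * (e1 - e2).
  by rewrite -T1 xE /p in K1; lra.
have E2 : w * (1 + v ^+ 2) + b ^+ 2 * v ^+ 2 = (e1 - e2) ^+ 2.
  by rewrite -T2 xE in K2; lra.
have E3 : (be1 - be2) ^+ 2 = w * (2 * (be1 + be2) - w).
  have AE : A = (be1 + be2 + b ^+ 2) / 2 - (w + b ^+ 2) / 4 by lra.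
  by rewrite AE xE /p in K0; lra.
have be1_0 : 0 <= be1 := le_trans (sqr_ge0 _) be1_ge.
have be2_0 : 0 <= be2 := le_trans (sqr_ge0 _) be2_ge.
have v2 : 0 < v ^+ 2 by rewrite exprn_even_gt0.
(* If [w != 0], [E3] gives [w > 0] and [E2] gives [w < (e1 - e2)^2]. Then [E4], rearranged as [w
   (e1^2 + e2^2) = (be1 + be2) (e1 - e2)^2], exceeds [w (be1 + be2)], against the bounds on [e1^2]
   and [e2^2]. *)
have w0 : w = 0.
  apply/eqP; apply: contraT => w_neq0.
  have w2 : 0 < w ^+ 2 by rewrite exprn_even_gt0.
  have S0 : 0 <= be1 + be2 := addr_ge0 be1_0 be2_0.
  have d0 := sqr_ge0 (be1 - be2).
  have wS : 0 < w * (be1 + be2) by lra.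
  have S_gt0 : 0 < be1 + be2.
    by rewrite lt_def S0 andbT; apply: contraTneq wS => ->; rewrite mulr0 ltxx.
  have w_gt0 : 0 < w by rewrite -(pmulr_lgt0 _ S_gt0).
  have E4 : w * (e1 + e2) ^+ 2 = (2 * (be1 + be2) - w) * (e1 - e2) ^+ 2.
    apply: (mulfI w_neq0).
    have -> : w * (w * (e1 + e2) ^+ 2) = (w * (e1 + e2)) ^+ 2 by ring.
    by rewrite E1 exprMn E3; ring.
  have dw : w < (e1 - e2) ^+ 2.
    rewrite -E2; have := mulr_gt0 w_gt0 v2; have := mulr_ge0 (sqr_ge0 b) (ltW v2); lra.
  have := mulr_gt0 S_gt0 (_ : 0 < (e1 - e2) ^+ 2 - w); rewrite subr_gt0 => /(_ dw).
  have := ler_wpM2l (ltW w_gt0) (lerD be1_ge be2_ge).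
  by move: E4; lra.
split.
- by apply: contraTneq x_gt0 => b0; rewrite xE w0 b0 expr0n addr0 ltxx.
- by apply/eqP; rewrite -subr_eq0 -sqrf_eq0 E3 w0 mul0r.
- by rewrite -E2 w0; ring.
Qed.

(** Support functions are subadditive and positively homogeneous, so the excess shrinks at rate at
    most [k] and stays positive for [r < gap / (1 + k)]. *)
Lemma exceed_support_perturb (R : realType) (A B C c s e1 e2 : R) (z0 z : R[i]) :
  0 < A -> 0 < A * C - B ^+ 2 ->
  let exceeds c s := c * complex.Re z0 + s * complex.Im z0
      + Num.sqrt (support_sq A B C c s) < c * complex.Re z + s * complex.Im z in
  exceeds c s -> exists2 rho, 0 < rho &
    forall r, 0 <= r < rho -> exceeds (c + r * e1) (s + r * e2).
Proof.
move=> A0 D0 exceeds ex_cs.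
set h := fun c s => c * complex.Re z0 + s * complex.Im z0 + Num.sqrt (support_sq A B C c s).
have hP c' s' : in_half_plane (centered_ellipse A B C z0) c' s' (h c' s').
  exact/in_half_plane_ellipse.
set gap := c * complex.Re z + s * complex.Im z - h c s.
have gap0 : 0 < gap by rewrite subr_gt0.
set k := `|h e1 e2 - (e1 * complex.Re z + e2 * complex.Im z)|.
have k1 : 0 < 1 + k by apply: ltr_pwDl => //; apply: normr_ge0.
exists (gap / (1 + k)) => [|r /andP[r0]]; first by rewrite divr_gt0.
rewrite ltr_pdivlMr // => r_gap.
have h_sub : h (c + r * e1) (s + r * e2) <= h c s + r * h e1 e2.
  apply/in_half_plane_ellipse => // z' Ez'.
  have := hP c s z' Ez'; have := ler_wpM2l r0 (hP e1 e2 z' Ez'); lra.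
have rk : r * (h e1 e2 - (e1 * complex.Re z + e2 * complex.Im z)) <= r * k.
  by rewrite ler_wpM2l // ler_norm.
by rewrite /exceeds -/(h _ _); move: h_sub rk r_gap; rewrite /gap; lra.
Qed.

(** A point outside the filled ellipse violates some support inequality; a perturbation makes
    [c != 0], scaling makes [c] a sign, and a second perturbation opens an interval of slopes. *)
Lemma exceed_support_slopes (R : realType) (A B C : R) (z0 z : R[i]) :
  0 < A -> 0 < A * C - B ^+ 2 -> ~ convex_hull (centered_ellipse A B C z0) z ->
  exists e a a' : R, [/\ e ^+ 2 = 1, a < a' & forall t, a <= t < a' ->
    e * complex.Re z0 + e * t * complex.Im z0 + Num.sqrt (support_sq A B C e (e * t))
      < e * complex.Re z + e * t * complex.Im z].
Proof.
move=> A0 D0 z_out; pose exceeds c s := c * complex.Re z0 + s * complex.Im z0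
      + Num.sqrt (support_sq A B C c s) < c * complex.Re z + s * complex.Im z.
have [c [s ex_cs]] : exists c s, exceeds c s.
  apply: contra_notP z_out => no_cs; apply: adj_form_le_hull => //.
  apply: adj_form_leP => // c s; rewrite leNgt; apply/negP => ex_cs.
  by apply: no_cs; exists c, s; rewrite /exceeds; lra.
wlog c0 : c s ex_cs / c != 0 => [wl|].
  have [c0|c0] := eqVneq c 0; last exact: wl ex_cs c0.
  have [rho rho0 ex_r] := exceed_support_perturb 1 0 A0 D0 ex_cs.
  apply: (wl _ _ (ex_r (rho / 2) _)).
    by apply/andP; split; lra.
  by rewrite c0 add0r mulr1 mulf_neq0 ?invr_eq0 ?pnatr_eq0 // gt_eqF.
set e := Num.sg c; have ee : e ^+ 2 = 1 by rewrite sqr_sg c0.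
have cE : c = e * `|c| by rewrite -numEsg.
have c_gt0 : 0 < `|c| by rewrite normr_gt0.
have ex_e : exceeds e (e * (s / c)).
  rewrite /exceeds -(ltr_pM2l c_gt0).
  have -> : `|c| * (e * complex.Re z0 + e * (s / c) * complex.Im z0
        + Num.sqrt (support_sq A B C e (e * (s / c))))
      = c * complex.Re z0 + s * complex.Im z0 + Num.sqrt (support_sq A B C c s).
    have -> : support_sq A B C c s = `|c| ^+ 2 * support_sq A B C e (e * (s / c)).
      have -> : `|c| ^+ 2 * support_sq A B C e (e * (s / c))
        = support_sq A B C (e * `|c|) (e * `|c| * (s / c)) by rewrite /support_sq; ring.
      by rewrite -cE mulrC divfK.
    rewrite sqrtrM ?sqr_ge0 // sqrtr_sqr normr_id.
    have -> : c * complex.Re z0 + s * complex.Im z0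
      = e * `|c| * complex.Re z0 + e * `|c| * (s / c) * complex.Im z0.
      by rewrite -cE [c * (s / c)]mulrC divfK.
    by ring.
  have -> : `|c| * (e * complex.Re z + e * (s / c) * complex.Im z)
      = c * complex.Re z + s * complex.Im z.
    transitivity (e * `|c| * complex.Re z + e * `|c| * (s / c) * complex.Im z); first by ring.
    by rewrite -cE [c * (s / c)]mulrC divfK.
  exact: ex_cs.
have [rho rho0 ex_r] := exceed_support_perturb 0 e A0 D0 ex_e.
exists e, (s / c), (s / c + rho); split=> //; first by rewrite ltrDl.
move=> t /andP[t_ge t_lt].
have := ex_r (t - s / c); rewrite subr_ge0 t_ge ltrBlDl t_lt => /(_ isT).
rewrite mulr0 addr0 (_ : e * (s / c) + _ = e * t) //; ring.
Qed.

(** Some point of [E1] lies beyond [E2] for all slopes in an interval, so there the support function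
    of the union is that of [E1]. Equating it with that of the numerical range feeds
    [sqrt_sum_identity]. *)
Lemma off_center_ellipse_conditions (R : realType) (v : R) (b1 b2 : R[i]) (b : R)
    (A B C A' B' C' : R) (z1 z2 : R[i]) :
  let E1 := centered_ellipse A B C z1 in let E2 := centered_ellipse A' B' C' z2 in
  v != 0 -> 0 < A -> 0 < A * C - B ^+ 2 -> 0 < A' -> 0 < A' * C' - B' ^+ 2 ->
  z1 != 0 -> ~ (E1 `<=` convex_hull E2)%classic ->
  numerical_range (mxA v b1 b2 b) = convex_hull (E1 `|` E2)%classic ->
  [/\ b != 0, dotc b1 b1 = dotc b2 b2
    & v ^+ 2 * b ^+ 2 = (complex.Im b1 - complex.Im b2) ^+ 2].
Proof.
move=> E1 E2 v0 A0 D0 A'0 D'0 z10 not_sub WE.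
have [z Ez z_out] : exists2 z, E1 z & ~ convex_hull E2 z.
  by apply: contra_notP not_sub => no_z z Ez; apply: contra_notP no_z => z_out; exists z.
have [e [a [a' [ee aa' ex_t]]]] := exceed_support_slopes A'0 D'0 z_out.
set x := e * complex.Re z1; set y := e * complex.Im z1.
have e0 : e != 0 by rewrite -sqrf_eq0 ee oner_eq0.
have xy0 : (x, y) != (0, 0).
  apply: contra z10; rewrite xpair_eqE !mulf_eq0 (negPf e0) /=.
  by rewrite eq_complex.
have qe A1 B1 C1 t : support_sq A1 B1 C1 e (e * t) = support_sq A1 B1 C1 1 t.
  have -> : support_sq A1 B1 C1 e (e * t) = e ^+ 2 * support_sq A1 B1 C1 1 t.
    by rewrite /support_sq; ring.
  by rewrite ee mul1r.
have K_ge0 t := let: And3 K0 _ _ := @in_half_plane_mxA _ v b1 b2 b e t 0 ee in K0.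
have [|y0 [K0 K1 K2 [T0 T1 T2]]] := sqrt_sum_identity A0 D0 xy0 aa' K_ge0
  (t0 := (dotc b1 b1 + dotc b2 b2 + b ^+ 2) / 2)
  (t1 := complex.Im b1 + complex.Im b2) (t2 := 1 + v ^+ 2).
  move=> t tab.
  set h1 := x + y * t + Num.sqrt (support_sq A B C 1 t).
  have E1P m : in_half_plane E1 e (e * t) m <-> h1 <= m.
    rewrite in_half_plane_ellipse // qe /h1 /x /y.
    by rewrite (_ : e * t * complex.Im z1 = e * complex.Im z1 * t) //; ring.
  have E1_h1 : in_half_plane E1 e (e * t) h1 by apply/E1P.
  have E2_h1 : in_half_plane E2 e (e * t) h1.
    by apply/in_half_plane_ellipse => //; apply: ltW; apply: lt_le_trans (ex_t t tab) (E1_h1 _ Ez).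
  have [_ l0 _] := @in_half_plane_mxA _ v b1 b2 b e t 0 ee.
  have hP m := let: And3 _ _ hP := @in_half_plane_mxA _ v b1 b2 b e t m ee in hP.
  rewrite -[RHS]sqr_sqrtr //; congr (_ ^+ 2); set hW := RHS.
  (* [hW] bounds the numerical range, hence [E1]; [h1] bounds [E1] and [E2], hence the numerical
     range. *)
  apply/eqP; rewrite eq_le; apply/andP; split.
    have /hP : hW <= hW := lexx hW.
    by rewrite WE => /in_half_plane_hull WP; apply/E1P => u Eu; apply: WP; left.
  by apply/hP; rewrite WE; apply/in_half_plane_hull => u [/E1_h1|/E2_h1].
have x0 : x != 0 by apply: contraNneq xy0 => x0; rewrite x0 y0.
apply: (coincidence_conditions v0 x0 _ _ K0 K1 K2 T0 T1 T2).
  by rewrite /dotc -!expr2 lerDr sqr_ge0.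
by rewrite /dotc -!expr2 lerDr sqr_ge0.
Qed.

Lemma normc_eq_dotc (R : realType) (x y : R[i]) : `|x| = `|y| <-> dotc x x = dotc y y.
Proof.
rewrite /dotc -!expr2; split=> [xy|xy]; last by rewrite !normc_def xy.
by apply: complexI; rewrite !add_Re2_Im2 xy.
Qed.

Unset Implicit Arguments.

Theorem theorem4 (R : realType) (v : R) (b1 b2 : R[i]) (b : R)
  (hv : v <> 0) (hb : 0 <= b) :
  let alpha : R[i] := 'i%C * v%:C in
  let A : 'M[R[i]]_4 := mx4
    [:: [:: alpha;  0;      b1^* + 1; 0        ];
        [:: 0;      alpha;  b%:C;     b2^* + 1 ];
        [:: b1 - 1; b%:C;   - alpha;  0        ];
        [:: 0;      b2 - 1; 0;        - alpha  ]] in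
  let eta1 := complex.Im b1 in
  let eta2 := complex.Im b2 in
  bi_elliptical (numerical_range A) <->
  [/\ b <> 0, `|b1| = `|b2| & v ^+ 2 * b ^+ 2 = (eta1 - eta2) ^+ 2].
Proof.
move=> alpha A eta1 eta2; rewrite -/(mxA v b1 b2 b) in A *.
split=> [[E1 [E2 [c1 [c2 [[ell1 ell2] c12 sub12 sub21 WE]]]]]|[b0 b12 vb]]; last first.
  apply: mxA_bi_elliptical => //; last exact/normc_eq_dotc.
  by rewrite lt_def hb andbT; apply/eqP.
have [A1 [B1 [C1 [A10 D10 E1E]]]] := is_ellipse_centered ell1.
have [A2 [B2 [C2 [A20 D20 E2E]]]] := is_ellipse_centered ell2.
have v0 : v != 0 by apply/eqP.
have [b0 b12 vb] : [/\ b != 0, dotc b1 b1 = dotc b2 b2 & v ^+ 2 * b ^+ 2 = (eta1 - eta2) ^+ 2].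
  (* Distinct centers cannot both be 0, and the two ellipses play symmetric roles. *)
  have [c10|c10] := eqVneq c1 0; last first.
    apply: (off_center_ellipse_conditions v0 A10 D10 A20 D20 c10 (z2 := c2)).
      by rewrite -E1E -E2E.
    by rewrite -E1E -E2E.
  have c20 : c2 != 0 by apply/eqP => c20; apply: c12; rewrite c10 c20.
  apply: (off_center_ellipse_conditions v0 A20 D20 A10 D10 c20 (z2 := c1)).
    by rewrite -E1E -E2E.
  by rewrite -E1E -E2E setUC.
by split=> //; [apply/eqP|apply/normc_eq_dotc].
Qed.
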